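(* Consider the peer-to-peer system described in the context, with mean peer arrival rate $\lambda>1$ per slot and a file decodable from any $k$ distinct chunks. If $\lambda<k$, then the system is stable, i.e. the Markov process of peer chunk profiles is positive recurrent.
   Context: Model. Time is slotted; one slot corresponds to the exchange of one chunk. There is a single file and one server. Using a fountain code, the server generates from the file an unlimited sequence of distinct chunks such that any $k$ distinct chunks suffice to decode the file. Peers arrive with on average $\lambda$ arrivals per slot, and the number of arrivals in each slot is greater than $1$ and less than a constant $A>0$. Only $\lambda>1$ is considered. Peers arrive empty (with no chunk). Server policy: the server can push chunks only at rate $1$ (one per slot), and pushes new chunks only to newly arriving peers. The arrival stream is split by independent coin tosses into a stream of rate $1$ (each arrival is selected with probability $1/\lambda$) and a stream of rate $\lambda-1$ (probability $(\lambda-1)/\lambda$). Each peer of the first stream receives on arrival a new (innovative) chunk from the server; each peer of the second stream joins the system empty. Peer policy: in each slot every peer $p$ selects a peer $q$ at random (uniformly) among all other peers in the system. If $q$ holds at least one chunk that $p$ does not hold, $p$ immediately downloads one such chunk, chosen at random among them; otherwise nothing is downloaded. A peer leaves the system as soon as it holds $k$ distinct chunks. The system is a Markov process whose state is the collection of peer chunk profiles (which chunks each present peer holds). ''Stable'' means that this Markov process is positive recurrent. *)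

(* Defs.v *)
From HB Require Import structures.
From mathcomp Require Import all_boot all_order all_algebra.
From mathcomp Require Import generic_quotient finmap.
From mathcomp Require Import all_classical all_reals all_analysis.

Set Implicit Arguments.
Unset Strict Implicit.
Unset Printing Implicit Defensive.

Import Order.TTheory GRing.Theory Num.Theory.

Local Open Scope fset_scope.
Local Open Scope quotient_scope.
Local Open Scope classical_set_scope.
Local Open Scope ring_scope.

Section MarkovChain.
Context {R : realType} {S : choiceType}.
Variable P : S -> S -> R.

(* [first_entrance B n x] is the probability, for the chain started at [x],
   that the first time [t >= 1] at which it is in [B] is [t = n.+1].  For
   [B = [set x]] these are the usual first-return probabilities of [x]. *)
Fixpoint first_entrance (B : set S) (n : nat) (x : S) : \bar R :=
  if n is m.+1 then
    (\esum_(y in ~` B) ((P x y)%:E * first_entrance B m y))%E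
  else (\esum_(y in B) (P x y)%:E)%E.

Definition hit_prob (B : set S) (x : S) : \bar R :=
  (\sum_(0 <= n <oo) first_entrance B n x)%E.

Definition mean_return_time (x : S) : \bar R :=
  (\sum_(0 <= n <oo) n.+1%:R%:E * first_entrance [set x] n x)%E.

Definition positive_recurrent_state (x : S) : Prop :=
  hit_prob [set x] x = 1%E /\ (mean_return_time x < +oo)%E.

Definition closed_class (C : set S) : Prop :=
  forall x y, C x -> P x y != 0 -> C y.

Definition irreducible_class (C : set S) : Prop :=
  forall x y, C x -> C y -> (0 < hit_prob [set y] x)%E.

(* The chain need not be irreducible on the whole of [S]: here, for instance,
   the system without peers can never be re-entered.  So inessential states are
   allowed, but from each of them the chain must be absorbed almost surely by
   the (then unique) closed irreducible class. *)
Definition positive_recurrent : Prop :=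
  exists C : set S,
    [/\ C !=set0, closed_class C, irreducible_class C,
        forall x, C x -> positive_recurrent_state x &
        forall x, hit_prob C x = 1%E].

End MarkovChain.

Section FiniteDistributions.
Context {R : realType}.

Definition dist (T : Type) : Type := seq (R * T).

Definition dret T (x : T) : dist T := [:: (1, x)].

Definition dbind T U (d : dist T) (f : T -> dist U) : dist U :=
  [seq (w.1 * v.1, v.2) | w <- d, v <- f w.2].

Definition duniform T (s : seq T) : dist T :=
  [seq ((size s)%:R^-1, x) | x <- s].

Fixpoint dindep T (ds : seq (dist T)) : dist (seq T) :=
  if ds is d :: ds' then
    dbind d (fun x => dbind (dindep ds') (fun xs => dret (x :: xs)))
  else dret [::].

Definition dprob T (d : dist T) (E : pred T) : R :=
  \sum_(w <- d | E w.2) w.1.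

End FiniteDistributions.
Arguments dist : clear implicits.

(* A profile is a set of chunks; chunks are named by natural numbers. *)
Notation profile k := {p : {fset nat} | (#|` p| < k)%N}.
Notation config k := (seq (profile k)).

Definition profiles k (s : config k) : seq {fset nat} := map val s.

Definition rename (f : nat -> nat) (p : {fset nat}) : {fset nat} :=
  [fset f c | c in p].

Lemma rename_comp f g p : rename (g \o f) p = rename g (rename f p).
Proof.
apply/fsetP => c; apply/imfsetP/imfsetP => [[d dp ->]|[e /imfsetP[d dp ->] ->]].
  by exists (f d) => //; apply/imfsetP; exists d.
by exists d.
Qed.

Lemma rename_id f p : f =1 id -> rename f p = p.
Proof.
move=> fid; apply/fsetP => c; apply/imfsetP/idP => [[d dp ->]|cp].
  by rewrite fid.
by exists c => //; rewrite fid.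
Qed.

(* Equality of two collections of profiles up to the order in which the peers
   are listed and up to the names given to the chunks. *)
Definition same_collection k (s t : config k) : bool :=
  `[< exists2 f : nat -> nat, bijective f &
        perm_eq (map (rename f) (profiles s)) (profiles t) >].

Lemma same_collection_refl k : reflexive (@same_collection k).
Proof.
move=> s; apply/asboolP; exists id; first by exists id.
by rewrite (eq_map (fun p => rename_id p (frefl id))) map_id.
Qed.

Lemma same_collection_trans k : transitive (@same_collection k).
Proof.
move=> t s u /asboolP[f bf st] /asboolP[g bg tu]; apply/asboolP.
exists (g \o f); first exact: bij_comp.
rewrite (eq_map (rename_comp f g)) map_comp.
exact: perm_trans (perm_map _ st) tu.
Qed.

Lemma same_collection_sym k : symmetric (@same_collection k).
Proof.
suff sub (s t : config k) : same_collection s t -> same_collection t s.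
  by move=> s t; apply/idP/idP; exact: sub.
move=> /asboolP[f [g fK gK] st]; apply/asboolP; exists g; first by exists f.
rewrite perm_sym in st; apply: perm_trans (perm_map _ st) _.
rewrite -[X in perm_eq X _](map_comp (rename g) (rename f)).
rewrite -(eq_map (rename_comp f g)).
by rewrite (eq_map (fun p => rename_id p (fK : g \o f =1 id))) map_id.
Qed.

Canonical same_collection_equiv k := EquivRel (@same_collection k)
  (@same_collection_refl k) (@same_collection_sym k) (@same_collection_trans k).

(* Chunk names are immaterial.  They have to be forgotten for recurrence to
   make sense: fresh chunks keep entering, so that a literal list of chunks,
   once its chunks have left the system, would never come back. *)
Notation state k := {eq_quot (same_collection_equiv k)}.

Section Dynamics.
Context {R : realType}.
Variables (k A : nat) (a : nat -> R) (lambda : R).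

Definition arrival_number : dist R nat := [seq (a n, n) | n <- iota 0 A].

(* [true]: the peer is put in the stream of rate 1. *)
Definition coin : dist R bool :=
  [:: (1 / lambda, true); ((lambda - 1) / lambda, false)].

(* All names from this one on are held by no peer of [t]. *)
Definition next_chunk (t : seq {fset nat}) : nat :=
  (\max_(p <- t) \max_(c <- p) c).+1.

(* The [i]-th arrival brings the new chunk [m + i] if selected. *)
Definition arrivals (m : nat) (cs : seq bool) : seq {fset nat} :=
  [seq if nth false cs i then [fset (m + i)%N] else fset0
  | i <- iota 0 (size cs)].

Definition with_arrivals (t : seq {fset nat}) : dist R (seq {fset nat}) :=
  dbind arrival_number (fun n =>
  dbind (dindep (nseq n coin)) (fun cs =>
  dret (t ++ arrivals (next_chunk t) cs))).

(* The profile of peer [i] after its contact in this slot. *)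
Definition contact (t : seq {fset nat}) (i : nat) : dist R {fset nat} :=
  let p := nth fset0 t i in
  dbind (duniform [seq j <- iota 0 (size t) | j != i]) (fun j =>
  let useful := (nth fset0 t j `\` p)%fset in
  if useful == fset0 then dret p
  else dbind (duniform (enum_fset useful)) (fun c => dret (c |` p)%fset)).

(* In a slot the newcomers join, then all peers make their contacts
   simultaneously (on the basis of the profiles held before the contacts), then
   the peers holding [k] chunks leave (this is [pmap insub]).  Since at least
   two peers arrive in every slot, no peer is ever without another peer to
   select. *)
Definition slot (s : config k) : dist R (config k) :=
  dbind (with_arrivals (profiles s)) (fun t =>
  dbind (dindep [seq contact t i | i <- iota 0 (size t)]) (fun t' =>
  dret (pmap insub t' : config k))).

(* The law of the next state does not depend on the representative, as [slot]
   commutes with reordering the peers and renaming the chunks. *)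
Definition transition (x y : state k) : R :=
  dprob (slot (repr x)) (fun s => \pi_(state k) s == y).

End Dynamics.

(* Main.v *)
Require Import Defs.
From HB Require Import structures.
From mathcomp Require Import all_boot all_order all_algebra.
From mathcomp Require Import generic_quotient finmap.
From mathcomp Require Import all_classical all_reals all_analysis.
From mathcomp Require Import zify ring lra.

(** Let [W] be the total number of chunks that the present peers still miss.  In
    a slot it increases by [k * lambda - 1] on average and decreases by the number
    of useful contacts.  Among many peers, useful contacts are rare only if all
    but boundedly many peers form a club with a common profile [S].  If
    [#|S| = k - 1], a newcomer holding a fresh chunk makes on average [k - 1] club
    members leave during its [k - 1] slots, then leaves itself, whereas an empty
    newcomer ends up in the club: the club grows at rate
    [(lambda - 1) - (k - 1) = lambda - k < 0].  If [#|S| < k - 1], a fresh chunk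
    makes of its holder a peer that can help the club for a long time.

    Accordingly the Lyapunov function is [W - min (Q, L)], where [Q] anticipates
    the downloads that the peers outside the club will make or cause.  The
    truncation at a constant [L] keeps it within [L] of [W], which suffices where
    useful contacts abound; where [Q] exceeds [L], many peers are outside the club
    and the truncation does no harm.

    Finally, if in [k] consecutive slots every peer contacts a seeded newcomer,
    the state obtained is, up to renaming, the same whatever the initial state:
    it is reached from everywhere, with a probability bounded below in terms of
    the number of peers, and Foster's criterion applies. *)

Set Implicit Arguments.
Unset Strict Implicit.
Unset Printing Implicit Defensive.

Import Order.TTheory GRing.Theory Num.Theory.
Local Open Scope ring_scope.

(** * Finite distributions *)

Section Expectation.
Context {R : realType}.
Implicit Types T U I : eqType.

Definition expect T (d : dist R T) (f : T -> R) : R :=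
  \sum_(w <- d) w.1 * f w.2.

Definition nonneg T (d : dist R T) : Prop := {in d, forall w, 0 <= w.1}.

Definition proba T (d : dist R T) : Prop :=
  nonneg d /\ \sum_(w <- d) w.1 = 1.

(** Entries of weight zero must be excluded: [arrival_number] lists every [n < A], whatever the
    value of [a n]. *)
Definition insupp T (d : dist R T) (x : T) : Prop :=
  exists2 r, 0 < r & (r, x) \in d.

Lemma le_expect T (d : dist R T) f g : nonneg d ->
  (forall x, insupp d x -> f x <= g x) -> expect d f <= expect d g.
Proof.
move=> d0 fg; rewrite /expect big_seq [leRHS]big_seq; apply: ler_sum => -[r x] xd.
have /= := d0 _ xd; rewrite le_eqVlt => /orP[/eqP<-|r0]; first by rewrite !mul0r.
by rewrite ler_pM2l//; apply: fg; exists r.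
Qed.

Lemma eq_expect T (d : dist R T) f g : nonneg d ->
  (forall x, insupp d x -> f x = g x) -> expect d f = expect d g.
Proof.
by move=> d0 fg; apply/eqP; rewrite eq_le; apply/andP; split; apply: le_expect => // x /fg ->.
Qed.

Lemma eq_expect_fun T (d : dist R T) f g : f =1 g -> expect d f = expect d g.
Proof. by move=> fg; apply: eq_bigr => w _; rewrite fg. Qed.

Lemma expectD T (d : dist R T) f g :
  expect d (fun x => f x + g x) = expect d f + expect d g.
Proof. by rewrite /expect -big_split/=; apply: eq_bigr => w _; rewrite mulrDr. Qed.

Lemma expectN T (d : dist R T) f : expect d (fun x => - f x) = - expect d f.
Proof. by rewrite /expect -sumrN; apply: eq_bigr => w _; rewrite mulrN. Qed.

Lemma expectB T (d : dist R T) f g :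
  expect d (fun x => f x - g x) = expect d f - expect d g.
Proof. by rewrite expectD expectN. Qed.

Lemma expectZ T (d : dist R T) c f : expect d (fun x => c * f x) = c * expect d f.
Proof. by rewrite /expect mulr_sumr; apply: eq_bigr => w _; rewrite mulrCA. Qed.

Lemma expect_cst T (d : dist R T) c : proba d -> expect d (fun=> c) = c.
Proof. by move=> [_ d1]; rewrite /expect -mulr_suml d1 mul1r. Qed.

Lemma expect_sum T (d : dist R T) I (s : seq I) (f : I -> T -> R) :
  expect d (fun x => \sum_(i <- s) f i x) = \sum_(i <- s) expect d (f i).
Proof.
rewrite /expect exchange_big/=; apply: eq_bigr => w _; by rewrite mulr_sumr.
Qed.

Lemma expect_ge0 T (d : dist R T) f : nonneg d ->
  (forall x, insupp d x -> 0 <= f x) -> 0 <= expect d f.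
Proof.
move=> d0 f0; have := @le_expect _ d (fun=> 0) f d0 f0.
by rewrite /expect [X in X <= _]big1// => w _; rewrite mulr0.
Qed.

Lemma expect_gt0 T (d : dist R T) f : nonneg d -> (forall x, 0 <= f x) ->
  0 < expect d f -> exists2 x, insupp d x & 0 < f x.
Proof.
move=> d0 f0; apply: contraPP => nex; apply/negP; rewrite -leNgt.
have -> : 0 = expect d (fun=> 0 : R).
  by rewrite /expect big1// => w _; rewrite mulr0.
by apply: le_expect => // x xd; rewrite leNgt; apply/negP => fx; apply: nex; exists x.
Qed.

Lemma expect_le_support T (d : dist R T) f r x : nonneg d ->
  (forall x, insupp d x -> 0 <= f x) -> (r, x) \in d -> r * f x <= expect d f.
Proof.
move=> d0 f0 xd; rewrite /expect (big_rem _ xd)/= lerDl big_seq.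
apply: sumr_ge0 => -[r' x'] /mem_rem/= xd'.
have /= := d0 _ xd'; rewrite le_eqVlt => /orP[/eqP<-|r0]; first by rewrite mul0r.
by rewrite mulr_ge0// ?(ltW r0)//; apply: f0; exists r'.
Qed.

Lemma expect_ret T (x : T) f : expect (dret x) f = f x :> R.
Proof. by rewrite /expect big_seq1 mul1r. Qed.

Lemma expect_bind T U (d : dist R T) (f : T -> dist R U) g :
  expect (dbind d f) g = expect d (fun x => expect (f x) g).
Proof.
rewrite /expect /dbind big_allpairs_dep/=; apply: eq_bigr => w _.
by rewrite mulr_sumr; apply: eq_bigr => v _; rewrite mulrA.
Qed.

Lemma sum_weights T (d : dist R T) : \sum_(w <- d) w.1 = expect d (fun=> 1).
Proof. by apply: eq_bigr => w _; rewrite mulr1. Qed.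

Lemma mem_bind T U (d : dist R T) (f : T -> dist R U) r x v y :
  (r, x) \in d -> (v, y) \in f x -> (r * v, y) \in dbind d f.
Proof. by move=> xd yf; apply/allpairsPdep; exists (r, x), (v, y). Qed.

Lemma nonneg_bind T U (d : dist R T) (f : T -> dist R U) : nonneg d ->
  (forall x, insupp d x -> nonneg (f x)) -> nonneg (dbind d f).
Proof.
move=> d0 f0 w /allpairsPdep[[r x] [v [xd vf ->]]]/=.
have /= := d0 _ xd; rewrite le_eqVlt => /orP[/eqP<-|r0]; first by rewrite mul0r.
by rewrite mulr_ge0 ?(ltW r0)//; apply: (f0 x) => //; exists r.
Qed.

Lemma proba_bind T U (d : dist R T) (f : T -> dist R U) : proba d ->
  (forall x, insupp d x -> proba (f x)) -> proba (dbind d f).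
Proof.
move=> [d0 d1] fP; split; first by apply: nonneg_bind => // x /fP[].
rewrite sum_weights expect_bind -[RHS]d1 sum_weights; apply: eq_expect => // x /fP xP.
exact: expect_cst.
Qed.

Lemma insupp_bind T U (d : dist R T) (f : T -> dist R U) y : nonneg d ->
  insupp (dbind d f) y -> exists2 x, insupp d x & insupp (f x) y.
Proof.
move=> d0 [r r0 /allpairsPdep[[r' x] [[v y'] /= [xd vf [rE yE]]]]]; subst r y'.
have /= := d0 _ xd; rewrite le_eqVlt => /orP[/eqP r'0|r'0].
  by move: r0; rewrite -r'0 mul0r ltxx.
by exists x; [exists r'|exists v => //; rewrite -(pmulr_rgt0 _ r'0)].
Qed.

Lemma proba_ret T (x : T) : proba (dret x : dist R T).
Proof.
split; first by move=> w; rewrite inE => /eqP ->.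
by rewrite big_seq1.
Qed.

Lemma insupp_ret T (x y : T) : insupp (dret x : dist R T) y -> y = x.
Proof. by move=> [r _]; rewrite inE => /eqP[_ ->]. Qed.

Lemma expect_uniform T (s : seq T) f :
  expect (duniform s) f = (size s)%:R^-1 * \sum_(x <- s) f x :> R.
Proof.
by rewrite /expect /duniform big_map/= mulr_sumr.
Qed.

Lemma proba_uniform T (s : seq T) : s != [::] -> proba (duniform s : dist R T).
Proof.
move=> s0; split; first by move=> w /mapP[x _ ->]; rewrite /= invr_ge0.
rewrite sum_weights expect_uniform big_tnth sumr_const card_ord mulVf//.
by rewrite pnatr_eq0 size_eq0.
Qed.

Lemma insupp_uniform T (s : seq T) x :
  insupp (duniform s : dist R T) x -> x \in s.
Proof. by move=> [r _ /mapP[y ys [_ ->]]]. Qed.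

Lemma mem_uniform T (s : seq T) x :
  x \in s -> ((size s)%:R^-1, x) \in (duniform s : dist R T).
Proof. by move=> xs; apply/mapP; exists x. Qed.

Lemma proba_indep T I (F : I -> dist R T) (s : seq I) :
  {in s, forall i, proba (F i)} -> proba (dindep (map F s)).
Proof.
elim: s => [|i s IH] Fs /=; first exact: proba_ret.
apply: proba_bind => [|x _]; first by apply: Fs; rewrite mem_head.
apply: proba_bind => [|xs _]; last exact: proba_ret.
by apply: IH => j js; apply: Fs; rewrite inE js orbT.
Qed.

Lemma insupp_indep T I (F : I -> dist R T) (s : seq I) xs :
  {in s, forall i, proba (F i)} -> insupp (dindep (map F s)) xs ->
  size xs = size s /\ {in zip s xs, forall z, insupp (F z.1) z.2}.
Proof.
elim: s xs => [|i s IH] xs Fs /=.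
  by move=> /insupp_ret ->.
have Fi : proba (F i) by apply: Fs; rewrite mem_head.
have Fs' : {in s, forall i, proba (F i)}.
  by move=> j js; apply: Fs; rewrite inE js orbT.
move=> /(insupp_bind Fi.1)[x xi] /(insupp_bind (proba_indep Fs').1)[ys yss].
move=> /insupp_ret ->; have [sy sz] := IH _ Fs' yss; split=> /=; first by rewrite sy.
by move=> z; rewrite inE => /predU1P[->|/sz].
Qed.

(** By linearity, only the marginal laws matter. *)
Lemma expect_indep_sum T I (F : I -> dist R T) (s : seq I) (g : I -> T -> R) :
  {in s, forall i, proba (F i)} ->
  expect (dindep (map F s)) (fun xs => \sum_(z <- zip s xs) g z.1 z.2)
  = \sum_(i <- s) expect (F i) (g i).
Proof.
elim: s => [|i s IH] Fs /=; first by rewrite expect_ret !big_nil.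
have Fi : proba (F i) by apply: Fs; rewrite mem_head.
have Fs' : {in s, forall i, proba (F i)}.
  by move=> j js; apply: Fs; rewrite inE js orbT.
rewrite expect_bind big_cons -IH//.
under eq_expect_fun => x.
  rewrite expect_bind.
  under eq_expect_fun => xs do rewrite expect_ret big_cons/=.
  rewrite expectD expect_cst; last exact: proba_indep.
  over.
by rewrite expectD expect_cst.
Qed.

(** Exhibits one explicit outcome with its weight, for use in lower bounds on probabilities. *)
Lemma mem_indep T I (F : I -> dist R T) (s : seq I) (r : R) (x : I -> T) :
  {in s, forall i, (r, x i) \in F i} ->
  (r ^+ size s, map x s) \in dindep (map F s).
Proof.
elim: s => [|i s IH] Fs /=; first by rewrite mem_head.
rewrite exprS; apply: (@mem_bind _ _ _ _ _ (x i)).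
  by apply: Fs; rewrite mem_head.
rewrite -[r ^+ _]mulr1; apply: (@mem_bind _ _ _ _ _ (map x s)).
  by apply: IH => j js; apply: Fs; rewrite inE js orbT.
by rewrite mem_head.
Qed.

End Expectation.

(** * Foster's criterion *)

Section FosterLyapunov.
Local Open Scope classical_set_scope.
Context {R : realType} {S : choiceType}.
Variables (P : S -> S -> R) (D : S -> dist R S).
Hypothesis D_proba : forall x, proba (D x).
Hypothesis PD : forall x y, P x y = dprob (D x) (pred1 y).

(** The probability that the chain started at [x] is outside [B] at times [1] to [n]; as in
    [first_entrance], the position at time [0] is not tested. *)
Fixpoint avoid (B : set S) (n : nat) (x : S) : R :=
  if n is m.+1 then expect (D x) (fun y => if y \in B then 0 else avoid B m y)
  else 1.

Let D_nonneg x : nonneg (D x). Proof. exact: (D_proba x).1. Qed.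

Lemma avoid_ge0 B n x : 0 <= avoid B n x.
Proof.
elim: n x => //= n IH x; apply: expect_ge0 => // y _.
by case: ifP.
Qed.

Lemma avoidS_le B n x : avoid B n.+1 x <= avoid B n x.
Proof.
elim: n x => [|n IH] x /=.
  rewrite -[leRHS](expect_cst 1 (D_proba x)); apply: le_expect => // y _.
  by case: ifP.
by apply: le_expect => // y _; case: ifP => // _; exact: IH.
Qed.

Lemma avoid_le1 B n x : avoid B n x <= 1.
Proof. by elim: n => [//|n IH]; apply: le_trans (avoidS_le _ _ _) IH. Qed.

Lemma avoid_sub (B B' : set S) n x : B `<=` B' -> avoid B' n x <= avoid B n x.
Proof.
move=> BB'; elim: n x => //= n IH x; apply: le_expect => // y _.
case: (boolP (y \in B)) => [/set_mem/BB'/mem_set ->//|_].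
by case: ifP => // _; exact: avoid_ge0.
Qed.

Lemma transition_ge0 x y : 0 <= P x y.
Proof. by rewrite PD /dprob big_seq_cond sumr_ge0// => w /andP[/D_nonneg]. Qed.

Lemma transitionE x y : P x y = expect (D x) (fun z => (z == y)%:R).
Proof.
by rewrite PD /dprob big_mkcond/=; apply: eq_bigr => w _; case: eqP; rewrite (mulr1,mulr0).
Qed.

(** Each [D x] is a finite list, so the two sums can be exchanged, and an entry of the list
    contributes to a single [y]. *)
Lemma esum_transition (A : set S) (g : S -> R) x : (forall y, 0 <= g y) ->
  (\esum_(y in A) ((P x y)%:E * (g y)%:E) =
   (expect (D x) (fun y => if y \in A then g y else 0))%:E)%E.
Proof.
move=> g0; rewrite /expect -sumEFin big_seq.
transitivity (\esum_(y in A) \sum_(w <- D x | w \in D x)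
   (if w.2 == y then (w.1 * g w.2)%:E else 0))%E.
  apply: eq_esum => y _; rewrite PD /dprob -EFinM big_seq_cond.
  rewrite mulr_suml -sumEFin big_mkcondr; apply: eq_bigr => w _.
  by rewrite /=; case: eqP => // ->.
rewrite esum_sum; last first.
  by move=> y w _ /D_nonneg w0; case: ifP => // _; rewrite lee_fin mulr_ge0.
apply: eq_bigr => w /D_nonneg w0.
rewrite esum_mkcond (_ : (fun y => _) = (fun y => if y \in [set w.2] then
   if y \in A then (w.1 * g y)%:E else 0 else 0))%E; last first.
  apply/funext => y; rewrite in_set1 eq_sym.
  by case: (y =P w.2) => [->|]; case: ifP.
rewrite -esum_mkcond esum_set1; first by case: ifP; rewrite ?mulr0.
by case: ifP => // _; rewrite lee_fin mulr_ge0.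
Qed.

(** Entering at time [n.+1] means avoiding [B] up to [n] but not up to [n.+1]. Hitting quantities
    thus become telescoping sums of reals. *)
Lemma first_entranceE B n x :
  first_entrance P B n x = (avoid B n x - avoid B n.+1 x)%:E.
Proof.
elim: n x => [|n IH] x.
  rewrite /= -[X in X - _](expect_cst 1 (D_proba x)) -expectB.
  rewrite (eq_esum (b := fun y => ((P x y)%:E * 1%:E)%E)); last first.
    by move=> y _; rewrite mule1.
  rewrite esum_transition//; congr (_%:E); apply: eq_expect_fun => y.
  by case: ifP; rewrite ?subr0 ?subrr.
rewrite [LHS]/= (eq_esum (b := fun y => ((P x y)%:E *
    (avoid B n y - avoid B n.+1 y)%:E)%E)); last by move=> y _; rewrite IH.
rewrite esum_transition; last by move=> y; rewrite subr_ge0 avoidS_le.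
congr (_%:E).
rewrite [X in X - _]/= [X in _ - X]/= -expectB.
by apply: eq_expect_fun => y; rewrite in_setC; case: (y \in B); rewrite ?subr0.
Qed.

Lemma first_entrance_ge0 B n x : (0 <= first_entrance P B n x)%E.
Proof. by rewrite first_entranceE lee_fin subr_ge0 avoidS_le. Qed.

Lemma sum_first_entrance B n x :
  (\sum_(0 <= i < n) first_entrance P B i x = (1 - avoid B n x)%:E)%E.
Proof.
under eq_bigr do rewrite first_entranceE.
rewrite sumEFin; congr (_%:E).
elim: n => [|n IH]; first by rewrite big_nil subrr.
rewrite big_nat_recr// IH; move: (avoid B n.+1 x) (avoid B n x) => p q /=; ring.
Qed.

Lemma hit_prob_gt0 B n x : avoid B n x < 1 -> (0 < hit_prob P B x)%E.
Proof.
move=> h; apply: lt_le_trans (nneseries_lim_ge n _); last first.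
  by move=> *; exact: first_entrance_ge0.
by rewrite sum_first_entrance lte_fin subr_gt0.
Qed.

Lemma avoid_antimono B m n x : (m <= n)%N -> avoid B n x <= avoid B m x.
Proof.
move=> /subnK <-; elim: (n - m)%N => // i IH.
by apply: le_trans IH; exact: avoidS_le.
Qed.

(** [avoid] is nonincreasing in time, so bounded partial sums force [avoid B n x <= K / n.+1], which
    tends to [0]. *)
Lemma hit_prob_eq1 B K x :
  (forall n, \sum_(0 <= i < n) avoid B i x <= K) -> hit_prob P B x = 1%E.
Proof.
move=> hK; apply/eqP; rewrite eq_le; apply/andP; split.
  apply: lime_le; first by apply: is_cvg_nneseries => *; exact: first_entrance_ge0.
  by apply: nearW => n; rewrite sum_first_entrance lee_fin gerBl avoid_ge0.
have small n : avoid B n x <= K / n.+1%:R.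
  rewrite ler_pdivlMr ?ltr0n// mulr_natr.
  apply: le_trans (hK n.+1); rewrite -[X in _ *+ X](subn0 n.+1) -sumr_const_nat.
  rewrite big_nat [leRHS]big_nat; apply: ler_sum => i /andP[_ ilt].
  exact: avoid_antimono.
have K0 : 0 <= K by apply: le_trans (hK 0%N); rewrite big_nil.
apply/lee_addgt0Pr => e e0.
pose n := Num.truncn (K / e).
have ne : K / n.+1%:R <= e.
  rewrite ler_pdivrMr ?ltr0n// mulrC -ler_pdivrMr//; apply/ltW.
  exact: truncnS_gt.
have := @nneseries_lim_ge R (fun i => first_entrance P B i x) xpredT 0 n
  (fun _ _ _ => first_entrance_ge0 _ _ _).
rewrite sum_first_entrance => h; apply: le_trans (leeD h (lexx e%:E)).
rewrite -EFinD lee_fin; have := le_trans (small n) ne; lra.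
Qed.

(** Summation by parts: the partial sums of the mean return time are those of [avoid] minus [n *
    avoid [set x] n x]. *)
Lemma mean_return_time_le K x :
  (forall n, \sum_(0 <= i < n) avoid [set x] i x <= K) ->
  (mean_return_time P x <= K%:E)%E.
Proof.
move=> hK; apply: lime_le.
  by apply: is_cvg_nneseries => *; rewrite mule_ge0 ?first_entrance_ge0.
apply: nearW => n; under eq_bigr do rewrite first_entranceE -EFinM.
rewrite sumEFin lee_fin; apply: le_trans (hK n).
rewrite -subr_ge0 (_ : _ - _ = n%:R * avoid [set x] n x).
  by rewrite mulr_ge0// avoid_ge0.
elim: n => [|n IH]; first by rewrite !big_nil mul0r subrr.
rewrite !big_nat_recr// opprD addrACA IH.
move: (avoid _ n.+1 _) (avoid _ n _) => p q.
by rewrite -natr1; ring.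
Qed.

Lemma avoid_step B n x y r : (r, y) \in D x ->
  r * (if y \in B then 1 else 1 - avoid B n y) <= 1 - avoid B n.+1 x.
Proof.
move=> xy; rewrite [avoid _ _.+1 _]/= -[X in _ <= X - _](expect_cst 1 (D_proba x)) -expectB.
have -> : (if y \in B then 1 else 1 - avoid B n y) =
  (fun y => 1 - if y \in B then 0 else avoid B n y) y.
  by case: ifP; rewrite ?subr0.
apply: (expect_le_support (f := fun y => 1 - if y \in B then 0 else avoid B n y)) => // z _.
by case: ifP; rewrite ?subr0// subr_ge0 avoid_le1.
Qed.

Lemma avoid_lt1_trans x y z n : avoid [set y] n x < 1 -> P y z != 0 ->
  exists m, avoid [set z] m x < 1.
Proof.
move=> + yz.
have {}yz : exists2 r, 0 < r & (r, z) \in D y.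
  have := transition_ge0 y z; rewrite le_eqVlt eq_sym (negPf yz)/= transitionE.
  move=> /(expect_gt0 (@D_nonneg y) (fun _ => ler0n _ _))[w [r r0 wr]].
  by case: eqP => [<- _|]; [exists r|rewrite ltxx].
have [r r0 yzr] := yz.
elim: n x => [|n IH] x; first by rewrite /= ltxx.
rewrite -subr_gt0 [avoid _ _.+1 _]/= -[X in X - _](expect_cst 1 (D_proba x)) -expectB.
move=> /(expect_gt0 (@D_nonneg x)) [w|w [s s0 xw]].
  by case: ifP; rewrite ?subr0// subr_ge0 avoid_le1.
rewrite subr_gt0; case: ifP => [/set_mem/= wy _|_ /IH[m hm]].
- subst w; exists 2%N; have := @avoid_step [set z] 1 x _ s xw.
  have := @avoid_step [set z] 0 y _ r yzr; rewrite mem_set// mulr1 => h1 h2.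
  rewrite -subr_gt0; apply: lt_le_trans h2; rewrite mulr_gt0//; case: ifP => // _.
  exact: lt_le_trans h1.
- exists m.+1; rewrite -subr_gt0; apply: lt_le_trans (avoid_step _ m xw).
  by rewrite mulr_gt0//; case: ifP => // _; rewrite subr_gt0.
Qed.

(** Markov property at the time when [y] is reached; a visit to [B] before that time only helps. *)
Lemma avoid_compose B y n l x :
  (1 - avoid [set y] n x) * (1 - avoid B l y) <= 1 - avoid B (n + l) x.
Proof.
elim: n x => [|n IH] x; first by rewrite subrr mul0r subr_ge0 avoid_le1.
rewrite addSn /= -[X in X - _](expect_cst 1 (D_proba x)).
rewrite -[X in _ <= X - _](expect_cst 1 (D_proba x)) -!expectB mulrC -expectZ.
have q0 : 0 <= 1 - avoid B l y by rewrite subr_ge0 avoid_le1.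
have q1 : 1 - avoid B l y <= 1 by rewrite gerBl avoid_ge0.
apply: le_expect => // z _; rewrite mulrC.
case: (boolP (z \in B)) => [_|zB].
  rewrite subr0; apply: mulr_ile1 => //; case: ifP; rewrite ?subr0// => _.
    by rewrite subr_ge0 avoid_le1.
  by rewrite gerBl avoid_ge0.
case: ifP => [/set_mem/= ->|_]; last exact: IH.
by rewrite subr0 mul1r lerB// avoid_antimono// leq_addl.
Qed.

(* [f x], the mean of the return time to [y] truncated at [n], decreases on
   average by the probability of reaching [y] within [n] steps: adding a large
   multiple of it to [V] makes the drift negative also on [F]. *)
Lemma foster (V : S -> R) (F : set S) (eps beta delta : R) n y :
  (forall x, 0 <= V x) -> 0 < eps -> 0 <= beta -> 0 < delta ->
  (forall x, ~ F x -> expect (D x) V <= V x - eps) ->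
  (forall x, F x -> expect (D x) V <= V x + beta) ->
  (forall x, F x -> delta <= 1 - avoid [set y] n x) ->
  forall x, exists K, forall m, \sum_(0 <= i < m) avoid [set y] i x <= K.
Proof.
move=> V0 eps0 beta0 delta0 Vout Vin hit.
pose f x := \sum_(0 <= i < n) avoid [set y] i x.
(* On [F] the term [M * f] loses at least [M * delta = beta + eps], which absorbs the increase
   [beta] and leaves a decrease [eps]. *)
pose M := (beta + eps) / delta.
have M0 : 0 <= M by rewrite divr_ge0 ?(ltW delta0)// addr_ge0// ltW.
pose W x := V x + M * f x.
pose killed (g : S -> R) x := expect (D x) (fun z => if z \in [set y] then 0 else g z).
have f0 x : 0 <= f x by rewrite sumr_ge0// => i _; exact: avoid_ge0.
have W0 x : 0 <= W x by apply: addr_ge0 => //; exact: mulr_ge0.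
(* One step of the killed chain turns [avoid] at [i] into [avoid] at [i.+1]: the sum loses its term
   [1] of index [0] and gains that of index [n]. *)
have Kf x : killed f x = f x - (1 - avoid [set y] n x).
  rewrite /killed (@eq_expect_fun _ _ _ _ (fun z => \sum_(0 <= i < n)
     (if z \in [set y] then 0 else avoid [set y] i z))); last first.
    by move=> z; case: ifP => // _; rewrite big1.
  rewrite expect_sum; have -> : f x - (1 - avoid [set y] n x) =
     \sum_(0 <= i < n.+1) avoid [set y] i x - 1 by rewrite big_nat_recr//= /f; ring.
  by rewrite big_nat_recl//= addrC addKr.
have KW x : killed W x <= W x - eps.
  have le1 : killed W x <= expect (D x) V + M * killed f x.
    rewrite /killed -expectZ -expectD; apply: le_expect => // z _.
    by case: ifP => _; rewrite ?mulr0 ?addr0 ?mulr1.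
  apply: le_trans le1 _; rewrite Kf /W.
  have [Fx|/Vout] := pselect (F x).
    have := Vin x Fx; have := ler_wpM2l M0 (hit x Fx).
    rewrite /M divfK ?gt_eqF// -/M; lra.
  have : 0 <= M * (1 - avoid [set y] n x) by rewrite mulr_ge0// subr_ge0 avoid_le1.
  lra.
(* Each step before the entrance into [y] costs [eps] out of [W]; hence [W x / eps] bounds the mean
   entrance time. *)
have main m : forall x, eps * \sum_(0 <= i < m) avoid [set y] i x <= W x.
  elim: m => [|m IH] x; first by rewrite big_nil mulr0.
  rewrite big_nat_recl//= mulrDr mulr1 mulr_sumr.
  suff : \sum_(0 <= i < m) eps * avoid [set y] i.+1 x <= killed W x.
    have := KW x; lra.
  apply: le_trans (_ : killed (fun z => eps * \sum_(0 <= i < m) avoid [set y] i z) x <= _); last first.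
    by apply: le_expect => // z _; case: ifP.
  rewrite /killed le_eqVlt; apply/orP; left; apply/eqP.
  rewrite -mulr_sumr -expect_sum -expectZ; apply: eq_expect_fun => z.
  by case: ifP => // _; rewrite big1 ?mulr0.
move=> x; exists (W x / eps) => m.
by rewrite ler_pdivlMr// mulrC.
Qed.

(* Foster's criterion, the finiteness of [F] being replaced by a uniform lower
   bound on the probability of reaching [x0] from [F]. *)
Lemma foster_positive_recurrent (V : S -> R) (F : set S) (eps beta delta : R) n x0 :
  (forall x, 0 <= V x) -> 0 < eps -> 0 <= beta -> 0 < delta ->
  (forall x, ~ F x -> expect (D x) V <= V x - eps) ->
  (forall x, F x -> expect (D x) V <= V x + beta) ->
  (forall x, F x -> delta <= 1 - avoid [set x0] n x) ->
  (forall x, exists m, avoid [set x0] m x < 1) ->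
  positive_recurrent P.
Proof.
move=> V0 eps0 beta0 delta0 Vout Vin hit reach.
(* The recurrent class: the states that can be reached from [x0]. *)
pose C := [set y | exists l, avoid [set y] l x0 < 1].
(* [foster] applies to each [y] of [C]: reach [x0] within [n] steps, then [y] within [l] more. *)
have Crec y : C y -> forall x, exists K, forall m,
    \sum_(0 <= i < m) avoid [set y] i x <= K.
  move=> [l hl]; apply: (@foster V F eps beta (delta * (1 - avoid [set y] l x0))
      (n + l)) => //.
    by rewrite mulr_gt0// subr_gt0.
  move=> x /hit hx; apply: le_trans (avoid_compose _ x0 _ _ _).
  by rewrite ler_pM2r ?subr_gt0.
have Cx0 : C x0 by exact: reach.
exists C; split.
- by exists x0.
- by move=> y z [l hl] /(avoid_lt1_trans hl).
- move=> x y _ [l hl]; have [m hm] := reach x; apply: (@hit_prob_gt0 _ (m + l)).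
  rewrite -subr_gt0; apply: lt_le_trans (avoid_compose _ _ _ _ _).
  by rewrite mulr_gt0// subr_gt0; [exact: hm|exact: hl].
- move=> y Cy; have [K hK] := Crec y Cy y; split; first exact: hit_prob_eq1 hK.
  exact: le_lt_trans (mean_return_time_le hK) (ltry _).
(* As [x0] lies in [C], avoiding [C] implies avoiding [x0]. *)
- move=> x; have [K hK] := Crec x0 Cx0 x; apply: (@hit_prob_eq1 _ K) => m.
  apply: le_trans (hK m); apply: ler_sum => i _; apply: avoid_sub.
  by move=> _ ->.
Qed.

End FosterLyapunov.

(** * Contacts *)

Section Contact.
Local Open Scope fset_scope.
Local Open Scope ring_scope.
Context {R : realType}.
Implicit Types (p q S : {fset nat}) (t xs : seq {fset nat}).

Definition exchange p q : dist R {fset nat} :=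
  if q `\` p == fset0 then dret p
  else dbind (duniform (enum_fset (q `\` p))) (fun c => dret (c |` p)).

Lemma proba_exchange p q : proba (exchange p q).
Proof.
rewrite /exchange; case: ifPn => [_|qp]; first exact: proba_ret.
apply: proba_bind => [|c _]; last exact: proba_ret.
apply: proba_uniform; apply: contra qp => /eqP qp.
by rewrite -cardfs_eq0 qp.
Qed.

Lemma insupp_exchange p q p' : insupp (exchange p q) p' ->
  p' = p /\ q `<=` p \/ exists c, [/\ c \in q, c \notin p & p' = c |` p].
Proof.
rewrite /exchange; case: ifPn => [qp|_].
  by move=> /insupp_ret ->; left; rewrite -fsetD_eq0.
move=> /insupp_bind[|c /insupp_uniform cqp /insupp_ret ->].
  by move=> w /mapP[x _ ->]; rewrite /= invr_ge0.
by right; exists c; move: cqp; rewrite in_fsetD => /andP[].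
Qed.

Lemma contactE t i : contact (R := R) t i =
  dbind (duniform [seq j <- iota 0 (size t) | j != i])
    (fun j => exchange (nth fset0 t i) (nth fset0 t j)).
Proof. by []. Qed.

Lemma size_others t i : (i < size t)%N ->
  size [seq j <- iota 0 (size t) | j != i] = (size t).-1.
Proof.
move=> it; rewrite size_filter; have := count_predC (pred1 i) (iota 0 (size t)).
rewrite size_iota (count_uniq_mem _ (iota_uniq _ _)) mem_iota it add1n => h.
by rewrite -[X in _ = X.-1]h.
Qed.

Lemma proba_contact t i : (1 < size t)%N -> (i < size t)%N ->
  proba (contact (R := R) t i).
Proof.
move=> t1 it; rewrite contactE; apply: proba_bind => [|j _].
  by apply: proba_uniform; rewrite -size_eq0 size_others//; lia.
exact: proba_exchange.
Qed.

Lemma expect_contact t i g : (i < size t)%N ->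
  expect (contact (R := R) t i) g = (size t).-1%:R^-1 *
    \sum_(j <- iota 0 (size t) | j != i)
      expect (exchange (nth fset0 t i) (nth fset0 t j)) g.
Proof.
by move=> it; rewrite contactE expect_bind expect_uniform size_others// big_filter.
Qed.

Lemma sum_iota_nth (M : nmodType) (F : {fset nat} -> M) t :
  \sum_(i <- iota 0 (size t)) F (nth fset0 t i) = \sum_(p <- t) F p.
Proof. by rewrite [RHS](big_nth fset0) /index_iota subn0. Qed.

Lemma expect_contact_le t i g (G : {fset nat} -> R) : (i < size t)%N ->
  (forall q, 0 <= G q) ->
  (forall q, expect (exchange (nth fset0 t i) q) g <= G q) ->
  expect (contact (R := R) t i) g <= (size t).-1%:R^-1 * \sum_(q <- t) G q.
Proof.
move=> it G0 gG; rewrite expect_contact// ler_wpM2l ?invr_ge0//.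
rewrite -(sum_iota_nth (fun q => G q)) [leLHS]big_mkcond/=.
by apply: ler_sum => j _; case: ifP.
Qed.

(** A peer never contacts itself, but [G] vanishes at its own profile, so the sum may run over all
    peers. *)
Lemma expect_contact_eq t i g (G : {fset nat} -> R) : (i < size t)%N ->
  G (nth fset0 t i) = 0 ->
  (forall q, expect (exchange (nth fset0 t i) q) g = G q) ->
  expect (contact (R := R) t i) g = (size t).-1%:R^-1 * \sum_(q <- t) G q.
Proof.
move=> it G0 gG; rewrite expect_contact//; congr (_ * _).
rewrite -(sum_iota_nth (fun q => G q)) [LHS]big_mkcond/=.
by apply: eq_bigr => j _; case: eqP => [->|]//=; rewrite gG.
Qed.

Definition grows p p' := p' = p \/ exists2 c, c \notin p & p' = c |` p.

Lemma insupp_contact t i p' : (1 < size t)%N -> (i < size t)%N ->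
  insupp (contact (R := R) t i) p' -> grows (nth fset0 t i) p'.
Proof.
move=> t1 it; rewrite contactE => /insupp_bind[].
  by apply: (proba_uniform _).1; rewrite -size_eq0 size_others//; lia.
by move=> j _ /insupp_exchange[[-> _]|[c [_ cp ->]]]; [left|right; exists c].
Qed.

Definition gain p p' : nat := #|` p'| - #|` p|.
Definition moved S p p' : nat := (p == S) && (p' != S).
(* [p] lies outside the club and [p'] cannot result from a contact with a club member. *)
Definition stray S p p' : nat := (p != S) &&
  ~~ [&& p `<=` p', p' `<=` p `|` S & #|` p'| == #|` p| + ~~ (S `<=` p) :> nat]%N.

Lemma expect_exchange_cst p q g (c : R) :
  (forall p', insupp (exchange p q) p' -> g p' = c) -> expect (exchange p q) g = c.
Proof.
move=> gc; rewrite (@eq_expect _ _ _ _ (fun=> c)) ?expect_cst//.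
  exact: proba_exchange.
by case: (proba_exchange p q).
Qed.

Lemma expect_gain t i : (i < size t)%N ->
  expect (contact (R := R) t i) (fun p' => (gain (nth fset0 t i) p')%:R) =
  (size t).-1%:R^-1 * \sum_(q <- t) (~~ (q `<=` nth fset0 t i))%:R.
Proof.
move=> it; apply: (@expect_contact_eq _ _ _
  (fun q => (~~ (q `<=` nth fset0 t i))%:R)) => // [|q].
  by rewrite fsubset_refl.
apply: expect_exchange_cst => p' /insupp_exchange[[-> ->]|[c [cq cp ->]]].
  by rewrite /gain subnn.
rewrite /gain cardfsU1 cp addnK; case: (boolP (q `<=` _)) => //= /fsubsetP/(_ _ cq).
by rewrite (negPf cp).
Qed.

Lemma expect_moved t i S : (i < size t)%N -> nth fset0 t i = S ->
  expect (contact (R := R) t i) (fun p' => (moved S (nth fset0 t i) p')%:R) =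
  (size t).-1%:R^-1 * \sum_(q <- t) (~~ (q `<=` S))%:R.
Proof.
move=> it tS; apply: (@expect_contact_eq _ _ _ (fun q => (~~ (q `<=` S))%:R)) => // [|q].
  by rewrite tS fsubset_refl.
rewrite tS; apply: expect_exchange_cst => p' /insupp_exchange[[-> ->]|[c [cq cp ->]]].
  by rewrite /moved eqxx.
rewrite /moved eqxx/=; have -> : (c |` S != S).
  by apply: contra cp => /eqP <-; rewrite in_fset1U eqxx.
case: (boolP (q `<=` _)) => //= /fsubsetP/(_ _ cq).
by rewrite (negPf cp).
Qed.

(** A contact with a club member never produces a stray move, so the probability is at most that of
    meeting a peer outside the club. *)
Lemma expect_stray t i S : (i < size t)%N -> nth fset0 t i != S ->
  expect (contact (R := R) t i) (fun p' => (stray S (nth fset0 t i) p')%:R) <=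
  (size t).-1%:R^-1 * \sum_(q <- t) (q != S)%:R.
Proof.
move=> it tS; apply: (@expect_contact_le _ _ _ (fun q => (q != S)%:R)) => // q.
rewrite /stray tS /=; have [->|_] := eqVneq q S.
  rewrite (@expect_exchange_cst _ _ _ 0)// => p'.
  move=> /insupp_exchange[[-> SP]|[c [cq cp ->]]].
    by rewrite fsubset_refl fsubsetUl SP /= addn0 eqxx.
  rewrite fsubsetU1 fsubUset fsub1set in_fsetU cq orbT fsubsetUl cardfsU1 cp.
  rewrite (_ : (S `<=` _) = false) /= ?add1n ?addn1 ?eqxx//.
  by apply/negP => /fsubsetP/(_ _ cq); rewrite (negPf cp).
apply: le_trans (_ : expect (exchange (nth fset0 t i) q) (fun=> 1) <= _); last first.
  by rewrite expect_cst//; exact: proba_exchange.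
by apply: le_expect => [|p' _]; [case: (proba_exchange (nth fset0 t i) q)|rewrite lern1 leq_b1].
Qed.

Definition outcomes t : dist R (seq {fset nat}) :=
  dindep [seq contact t i | i <- iota 0 (size t)].

Lemma proba_contacts t : (1 < size t)%N ->
  {in iota 0 (size t), forall i, proba (contact (R := R) t i)}.
Proof. by move=> t1 i; rewrite mem_iota => it; exact: proba_contact. Qed.

Lemma proba_outcomes t : (1 < size t)%N -> proba (outcomes t).
Proof. by move=> t1; apply: proba_indep; exact: proba_contacts. Qed.

Lemma zip_nth (T : Type) t (xs : seq T) :
  zip t xs = [seq (nth fset0 t z.1, z.2) | z <- zip (iota 0 (size t)) xs].
Proof.
rewrite -{1}[t](mkseq_nth fset0) /mkseq.
elim: (iota _ _) xs => [|i s IH] [|x xs]//=; by rewrite IH.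
Qed.

Lemma insupp_outcomes t xs : (1 < size t)%N -> insupp (outcomes t) xs ->
  size xs = size t /\ {in zip t xs, forall z, grows z.1 z.2}.
Proof.
move=> t1 /(insupp_indep (proba_contacts t1))[]; rewrite size_iota => xt xz.
split=> // z; rewrite zip_nth => /mapP[[i x] ix ->]/=.
apply: insupp_contact => //; last exact: (xz _ ix).
move: ix => /(map_f fst)/=; rewrite -/(unzip1 _) unzip1_zip ?mem_iota//.
by rewrite size_iota xt.
Qed.

Lemma expect_outcomes_sum t (g : {fset nat} -> {fset nat} -> nat) : (1 < size t)%N ->
  expect (outcomes t) (fun xs => (\sum_(z <- zip t xs) g z.1 z.2)%N%:R) =
  \sum_(i <- iota 0 (size t))
    expect (contact t i) (fun p' => (g (nth fset0 t i) p')%:R).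
Proof.
move=> t1; rewrite -(expect_indep_sum (fun i p' => (g (nth fset0 t i) p')%:R)
  (proba_contacts t1)).
apply: eq_expect_fun => xs; rewrite natr_sum zip_nth big_map/=.
by [].
Qed.

Lemma natr_count (T : Type) (a : pred T) (s : seq T) :
  \sum_(x <- s) (a x)%:R = (count a s)%:R :> R.
Proof.
by elim: s => [|x s IH]; rewrite ?big_nil// big_cons IH/= natrD.
Qed.

Lemma expect_sum_gain t : (1 < size t)%N ->
  expect (outcomes t) (fun xs => (\sum_(z <- zip t xs) gain z.1 z.2)%N%:R) =
  (size t).-1%:R^-1 * (\sum_(p <- t) count (fun q => ~~ (q `<=` p)) t)%N%:R.
Proof.
move=> t1; rewrite expect_outcomes_sum// natr_sum mulr_sumr.
rewrite -(sum_iota_nth (fun p => _ * (count (fun q => ~~ (q `<=` p)) t)%:R)).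
rewrite big_seq [RHS]big_seq; apply: eq_bigr => i; rewrite mem_iota => it.
by rewrite expect_gain// natr_count.
Qed.

(** When almost all peers are in the club, this mean is close to the number of peers that hold a
    chunk outside [S]. *)
Lemma expect_sum_moved t S : (1 < size t)%N ->
  expect (outcomes t) (fun xs => (\sum_(z <- zip t xs) moved S z.1 z.2)%N%:R) =
  (size t).-1%:R^-1 * (count_mem S t * count (fun q => ~~ (q `<=` S)) t)%N%:R.
Proof.
move=> t1; rewrite expect_outcomes_sum// natrM mulrCA -natr_count mulr_suml.
rewrite -(sum_iota_nth (fun p => (pred1 S p)%:R * (_ * (count _ t)%:R))).
rewrite big_seq [RHS]big_seq; apply: eq_bigr => i; rewrite mem_iota => it.
rewrite -natr_count /=; case: eqP => [tS|tS]; first by rewrite expect_moved// mul1r.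
rewrite mul0r; rewrite (_ : (fun _ => _) = fun=> 0) ?expect_cst//.
  exact: proba_contact.
by apply/funext => p'; rewrite /moved; case: eqP.
Qed.

Lemma expect_sum_stray t S : (1 < size t)%N ->
  expect (outcomes t) (fun xs => (\sum_(z <- zip t xs) stray S z.1 z.2)%N%:R) <=
  (size t).-1%:R^-1 * (count (predC1 S) t * count (predC1 S) t)%N%:R.
Proof.
move=> t1; rewrite expect_outcomes_sum// natrM mulrCA -natr_count mulr_suml.
rewrite -(sum_iota_nth (fun p => (predC1 S p)%:R * (_ * _))).
rewrite big_seq [leRHS]big_seq; apply: ler_sum => i; rewrite mem_iota => it.
rewrite /=; case: (eqVneq (nth fset0 t i) S) => [tS|tS]; last first.
  by rewrite mul1r; exact: expect_stray.
rewrite mul0r; rewrite (_ : (fun _ => _) = fun=> 0) ?expect_cst//.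
  exact: proba_contact.
by apply/funext => p'; rewrite /stray tS eqxx.
Qed.

End Contact.

(** * The Lyapunov function *)

Section Lyapunov.
Local Open Scope fset_scope.
Local Open Scope nat_scope.
Variables (k C L : nat).
Implicit Types (p q S : {fset nat}) (s t xs : seq {fset nat}).

Definition missing t := \sum_(p <- t) (k - #|` p|).

(* The anticipated effect of a peer [p] outside the club [S].  When
   [#|S| = k - 1], a peer holding a chunk outside [S] will make [k - #|p|] more
   downloads and as many uploads to the club.  Otherwise, only the peers that can
   absorb the whole of [S] without leaving are counted. *)
Definition aid S p : nat :=
  if #|` S| == k.-1 then
    if p `<=` S then k.-1 - #|` p| else 2 * (k - #|` p|)
  else C * (~~ (p `<=` S) && (#|` p `|` S| < k)).

Definition total_aid S t := \sum_(p <- t) aid S p.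

Definition club S t := size t < 2 * count_mem S t.

(** By [club_unique] the maximum concerns a single profile; without a club it is [0]. *)
Definition discount t := \max_(S <- t | club S t) minn (total_aid S t) L.

(** The shift by [L] keeps the value a natural number; by [discount_le] the subtraction is exact. *)
Definition lyap t := missing t + (L - discount t).

Lemma discount_le t : discount t <= L.
Proof. by apply/bigmax_leqP_seq => S _ _; rewrite geq_minr. Qed.

Lemma club_mem S t : club S t -> S \in t.
Proof. by rewrite /club -has_pred1 has_count; lia. Qed.

Lemma discount_ge S t : club S t -> minn (total_aid S t) L <= discount t.
Proof. by move=> St; apply: leq_bigmax_seq => //; exact: club_mem. Qed.

(** Two distinct strict majorities would together exceed the number of peers. *)
Lemma club_unique S S' t : club S t -> club S' t -> S' = S.
Proof.
rewrite /club => St S't; apply/eqP/negPn/negP => SS'.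
have := count_predUI (pred1 S) (pred1 S') t.
have -> : count (predI (pred1 S) (pred1 S')) t = 0.
  rewrite (@eq_count _ _ pred0) ?count_pred0// => p /=.
  by case: eqP => //= ->; rewrite eq_sym (negPf SS').
have := count_size (predU (pred1 S) (pred1 S')) t.
move: St S't; move: (count_mem S t) (count_mem S' t) (count (predU _ _) t) => a b c => /=; lia.
Qed.

Lemma discount_le_club S t : club S t -> discount t <= minn (total_aid S t) L.
Proof.
by move=> St; apply/bigmax_leqP_seq => S' _ /(club_unique St) ->.
Qed.

Definition kept xs := [seq p <- xs | #|` p| < k].

Lemma missing_kept xs : missing (kept xs) = missing xs.
Proof.
rewrite /missing /kept big_filter big_mkcond; apply: eq_bigr => p _.
by case: ltnP => // /eqP ->.
Qed.

(** Departing peers carry no aid, so departures leave [total_aid] unchanged. *)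
Lemma aid_full S p : #|` S| < k -> k <= #|` p| -> aid S p = 0.
Proof.
move=> Sk kp; have pS : (p `<=` S) = false.
  by apply/negP => /fsubset_leq_card; lia.
rewrite /aid pS; have /eqP -> : k - #|` p| == 0 by [].
have := fsubset_leq_card (fsubsetUl p S).
by case: ifP => // _ h; rewrite (_ : (_ < k) = false) ?muln0//; lia.
Qed.

Lemma total_aid_kept S xs : #|` S| < k -> total_aid S (kept xs) = total_aid S xs.
Proof.
move=> Sk; rewrite /total_aid /kept big_filter big_mkcond; apply: eq_bigr => p _.
by case: ltnP => // /(aid_full Sk) ->.
Qed.

Lemma count_kept S xs : #|` S| < k -> count_mem S (kept xs) = count_mem S xs.
Proof.
move=> Sk; rewrite count_filter; apply: eq_count => p /=.
by case: eqP => [->|].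
Qed.

Lemma size_kept xs : size (kept xs) <= size xs.
Proof. by rewrite size_filter count_size. Qed.

Lemma missing_cat s t : missing (s ++ t) = missing s + missing t.
Proof. by rewrite /missing big_cat. Qed.

Lemma total_aid_cat S s t : total_aid S (s ++ t) = total_aid S s + total_aid S t.
Proof. by rewrite /total_aid big_cat. Qed.

Lemma sum_zip1 (F : {fset nat} -> nat) t xs : size xs = size t ->
  \sum_(p <- t) F p = \sum_(z <- zip t xs) F z.1.
Proof. by move=> xt; rewrite -(big_map fst xpredT F) -/(unzip1 _) unzip1_zip ?xt. Qed.

Lemma sum_zip2 (F : {fset nat} -> nat) t xs : size xs = size t ->
  \sum_(p <- xs) F p = \sum_(z <- zip t xs) F z.2.
Proof. by move=> xt; rewrite -(big_map snd xpredT F) -/(unzip2 _) unzip2_zip ?xt. Qed.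

Lemma sumb_count (T : Type) (a : pred T) (s : seq T) :
  \sum_(x <- s) (a x : nat) = count a s.
Proof. by elim: s => [|x s IH]; rewrite ?big_nil// big_cons IH. Qed.

Lemma zip_mem1 (T T' : eqType) (t : seq T) (xs : seq T') z :
  size xs = size t -> z \in zip t xs -> z.1 \in t.
Proof. by move=> xt /(map_f fst); rewrite -/(unzip1 _) unzip1_zip// xt. Qed.

Lemma card_grows p p' : grows p p' ->
  p' = p \/ p' != p /\ #|` p'| = #|` p|.+1.
Proof.
move=> [->|[c cp ->]]; [by left|right]; split; last by rewrite cardfsU1 cp.
by apply: contra cp => /eqP <-; rewrite in_fset1U eqxx.
Qed.

Lemma missing_gain p p' : #|` p| < k -> grows p p' ->
  (k - #|` p'|) + gain p p' = k - #|` p|.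
Proof. by rewrite /gain => pk /card_grows[->|[_ ->]]; lia. Qed.

Lemma moved_le_gain S p p' : grows p p' -> moved S p p' <= gain p p'.
Proof.
by rewrite /moved /gain; case: eqP => //= <- /card_grows[->|[_ ->]]; rewrite ?eqxx// subSnn leq_b1.
Qed.

Lemma not_stray S p p' : stray S p p' = 0 -> p != S ->
  [/\ p `<=` p', p' `<=` p `|` S & #|` p'| = #|` p| + ~~ (S `<=` p)].
Proof.
move=> /eqP + pS; rewrite /stray pS/= eqb0 negbK.
by move=> /and3P[? ? /eqP].
Qed.

(** Barring strays, a peer outside the club behaves as if it had contacted a club member. When [S]
    has [k.-1] chunks, no other profile of fewer than [k] chunks contains [S], so this peer
    downloads exactly one chunk. *)
Lemma missing_large S p p' : #|` S| = k.-1 -> #|` p| < k ->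
  grows p p' -> stray S p p' = 0 ->
  (k - #|` p'|) + (p != S) + moved S p p' = k - #|` p|.
Proof.
move=> Sk pk pp' st; rewrite -(missing_gain pk pp') -addnA; congr addn.
rewrite /moved /gain; case: (eqVneq p S) => [<-|pS] /=.
  by case: (card_grows pp') => [->|[-> ->]]; rewrite ?eqxx/=; lia.
have [_ _ ->] := not_stray st pS; rewrite (_ : (S `<=` p) = false) /=; first by lia.
apply/negP => Sp; have := @fproper_ltn_card _ S p.
by rewrite fproperEneq eq_sym pS Sp => /(_ isT); lia.
Qed.

(** A peer strictly inside [S] spends one unit by its download; a peer with a chunk outside [S]
    spends two, for the download and for the upload expected of it. *)
Lemma aid_large S p p' : #|` S| = k.-1 -> #|` p| < k ->
  grows p p' -> stray S p p' = 0 ->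
  aid S p' + (p != S) + ~~ (p `<=` S) = aid S p.
Proof.
move=> Sk pk pp' st; rewrite /aid Sk eqxx.
have [pS|pS] := eqVneq p S.
  rewrite pS fsubset_refl Sk subnn; rewrite pS in pp'.
  case: (card_grows pp') => [->|[_ c']]; first by rewrite fsubset_refl Sk; lia.
  case: ifP => [/fsubset_leq_card|_]; lia.
have [pp'S p'S] := not_stray st pS.
rewrite (_ : (S `<=` p) = false) /=; last first.
  apply/negP => Sp; have := @fproper_ltn_card _ S p.
  by rewrite fproperEneq eq_sym pS Sp => /(_ isT); lia.
move=> cp'; case: (boolP (p `<=` S)) => pinS.
  rewrite (_ : p' `<=` S); last by rewrite (fsubset_trans p'S)// fsubUset pinS fsubset_refl.
  have := @fproper_ltn_card _ p S.
  by rewrite fproperEneq pS pinS => /(_ isT); rewrite Sk cp' /=; lia.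
rewrite (_ : (p' `<=` S) = false); last first.
  by apply: contraNF pinS; exact: fsubset_trans.
rewrite cp' /=; move: pk => /=.
lia.
Qed.

(** Downloading from [S] does not enlarge the union of [p] with [S], and a chunk outside [S] stays
    held. *)
Lemma aid_small S p p' : #|` S| != k.-1 -> stray S p p' = 0 -> grows p p' ->
  aid S p <= aid S p'.
Proof.
move=> /negPf Sk st pp'; rewrite /aid Sk.
have [->|pS] := eqVneq p S; first by rewrite fsubset_refl muln0.
have [pp'S p'S _] := not_stray st pS.
rewrite leq_mul2l; apply/orP; right.
case: (boolP (p `<=` S)) => //= pinS.
rewrite (_ : (p' `<=` S) = false) /=; last by apply: contraNF pinS; exact: fsubset_trans.
have : #|` p' `|` S| <= #|` p `|` S|.
  by apply: fsubset_leq_card; rewrite fsubUset p'S fsubsetUr.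
by case: (ltnP #|` p `|` S|) => //= h1 h2; rewrite (leq_ltn_trans h2 h1).
Qed.

(** The factor of [k.-1] is the decrement per slot in [aid_large]: a large total aid forces a large
    decrement. *)
Lemma aid_large_le S p : #|` S| = k.-1 -> #|` p| < k ->
  aid S p <= k.-1 * ((p != S) + ~~ (p `<=` S)).
Proof.
move=> Sk pk; rewrite /aid Sk eqxx; case: (boolP (p `<=` S)) => pS.
  have [->|/=] := eqVneq p S; lia.
rewrite (_ : p != S); last by apply: contra pS => /eqP ->.
have : 0 < #|` p|.
  rewrite lt0n cardfs_eq0; apply: contra pS => /eqP ->; exact: fsub0set.
by rewrite /=; nia.
Qed.

Lemma aid_small_le S p : #|` S| != k.-1 -> aid S p <= C * ~~ (p `<=` S).
Proof.
by move=> /negPf Sk; rewrite /aid Sk leq_mul2l; case: (p `<=` S); rewrite /= ?leq_b1 orbT.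
Qed.

Section Pointwise.
Variables (t xs : seq {fset nat}).
Hypothesis xt : size xs = size t.
Hypothesis t_grows : {in zip t xs, forall z, grows z.1 z.2}.
Hypothesis tk : {in t, forall p, #|` p| < k}.

Let zk z : z \in zip t xs -> #|` z.1| < k.
Proof. by move=> /(zip_mem1 xt)/tk. Qed.

Lemma missing_outcome :
  missing xs + \sum_(z <- zip t xs) gain z.1 z.2 = missing t.
Proof.
rewrite /missing (sum_zip1 _ xt) (sum_zip2 _ xt) -big_split/= big_seq [RHS]big_seq.
by apply: eq_bigr => z zt; apply: missing_gain; [exact: zk|exact: t_grows].
Qed.

Lemma missing_outcome_moved S :
  missing xs + \sum_(z <- zip t xs) moved S z.1 z.2 <= missing t.
Proof.
rewrite -missing_outcome leq_add2l big_seq [leqRHS]big_seq.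
by apply: leq_sum => z /t_grows; exact: moved_le_gain.
Qed.

Lemma count_outcome S :
  count_mem S t <= count_mem S xs + \sum_(z <- zip t xs) moved S z.1 z.2.
Proof.
rewrite -!sumb_count (sum_zip1 _ xt) (sum_zip2 _ xt) -big_split/=.
apply: leq_sum => z _; rewrite /moved.
by case: eqP => //= _; case: eqP.
Qed.

Section Club.
Variable S : {fset nat}.
Hypothesis Sk : #|` S| < k.
Hypothesis no_stray : \sum_(z <- zip t xs) stray S z.1 z.2 = 0.
Hypothesis few_moved :
  size t + 2 * \sum_(z <- zip t xs) moved S z.1 z.2 < 2 * count_mem S t.

Let zst z : z \in zip t xs -> stray S z.1 z.2 = 0.
Proof.
by move=> zt; have /eqP := no_stray; rewrite sum_nat_seq_eq0 => /allP/(_ _ zt)/eqP.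
Qed.

(** By [few_moved], [S] keeps a strict majority after losing its moved members; its holders have
    fewer than [k] chunks and stay, while departures only lower the size. *)
Lemma club_outcome : club S (kept xs).
Proof.
rewrite /club count_kept//; apply: leq_ltn_trans (size_kept xs) _; rewrite xt.
rewrite -(ltn_add2r (2 * \sum_(z <- zip t xs) moved S z.1 z.2)).
apply: leq_trans few_moved _; rewrite -mulnDr leq_mul2l; exact: count_outcome.
Qed.

Lemma discount_outcome : minn (total_aid S xs) L <= discount (kept xs).
Proof. by rewrite -(total_aid_kept _ Sk); apply: discount_ge; exact: club_outcome. Qed.

Lemma missing_outcome_large : #|` S| = k.-1 ->
  missing xs + count (predC1 S) t + \sum_(z <- zip t xs) moved S z.1 z.2
  = missing t.
Proof.
move=> Sk1; rewrite -sumb_count /missing !(sum_zip1 _ xt) (sum_zip2 _ xt) -!big_split/=.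
rewrite big_seq [RHS]big_seq; apply: eq_bigr => z zt.
by apply: missing_large => //; [exact: zk|exact: t_grows|exact: zst].
Qed.

Lemma total_aid_outcome_large : #|` S| = k.-1 ->
  total_aid S xs + count (predC1 S) t + count (fun p => ~~ (p `<=` S)) t
  = total_aid S t.
Proof.
move=> Sk1; rewrite -!sumb_count /total_aid !(sum_zip1 _ xt) (sum_zip2 _ xt) -!big_split/=.
rewrite big_seq [RHS]big_seq; apply: eq_bigr => z zt.
by apply: aid_large => //; [exact: zk|exact: t_grows|exact: zst].
Qed.

Lemma total_aid_outcome_small : #|` S| != k.-1 -> total_aid S t <= total_aid S xs.
Proof.
move=> Sk1; rewrite /total_aid (sum_zip1 _ xt) (sum_zip2 _ xt).
rewrite big_seq [leqRHS]big_seq; apply: leq_sum => z zt.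
by apply: aid_small => //; [exact: zst|exact: t_grows].
Qed.

End Club.

Lemma total_aid_large_le S : #|` S| = k.-1 ->
  total_aid S t <= k.-1 * (count (predC1 S) t + count (fun p => ~~ (p `<=` S)) t).
Proof.
move=> Sk1; rewrite /total_aid -!sumb_count -big_split big_distrr/=.
rewrite big_seq [leqRHS]big_seq; apply: leq_sum => p pt.
by apply: aid_large_le => //; exact: tk.
Qed.

Lemma total_aid_small_le S : #|` S| != k.-1 ->
  total_aid S t <= C * count (fun p => ~~ (p `<=` S)) t.
Proof.
by move=> Sk1; rewrite /total_aid -sumb_count big_distrr/=; apply: leq_sum => p _; exact: aid_small_le.
Qed.

End Pointwise.
End Lyapunov.

(** * Contribution of the newcomers *)

Section Arrivals.
Local Open Scope fset_scope.
Local Open Scope nat_scope.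
Implicit Types (p q S : {fset nat}) (s t xs : seq {fset nat}) (cs : seq bool).

Lemma size_arrivals m cs : size (arrivals m cs) = size cs.
Proof. by rewrite size_map size_iota. Qed.

Lemma sum_arrivals (F : {fset nat} -> nat) x y m cs :
  (forall i, F [fset (m + i)%N] = x) -> F fset0 = y ->
  \sum_(p <- arrivals m cs) F p = x * count id cs + y * count negb cs.
Proof.
move=> Fx Fy; rewrite big_map.
rewrite (eq_bigr (fun i => if nth false cs i then x else y)); last first.
  by move=> i _; case: ifP.
have -> : \sum_(i <- iota 0 (size cs)) (if nth false cs i then x else y) =
    \sum_(b <- cs) (if b then x else y).
  by rewrite [RHS](big_nth false) /index_iota subn0.
by elim: cs => [|[] cs IH]; rewrite ?big_nil ?big_cons ?IH/=; lia.
Qed.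

Lemma card_arrivals m cs p : p \in arrivals m cs -> #|` p| <= 1.
Proof. by move=> /mapP[i _ ->]; case: ifP; rewrite ?cardfs1 ?cardfs0. Qed.

Lemma next_chunk_gt t p c : p \in t -> c \in p -> c < next_chunk t.
Proof.
move=> pt cp; rewrite /next_chunk ltnS.
apply: (@leq_trans (\max_(c <- p) c)).
  by have := @leq_bigmax_seq _ (enum_fset p) xpredT id c cp isT.
by have := @leq_bigmax_seq _ t xpredT (fun p : {fset nat} => \max_(c <- p) c) p pt isT.
Qed.

Lemma fresh_notin t p i : p \in t -> next_chunk t + i \notin p.
Proof. by move=> pt; apply/negP => /(next_chunk_gt pt); lia. Qed.

Lemma count_negb cs : count id cs + count negb cs = size cs.
Proof. by rewrite -(count_predC id cs); congr addn; apply: eq_count. Qed.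

(** Each helper contributes at most [m.+1] to the aid. With [m = k * A], an aid above [L / 2]
    requires enough helpers to outweigh the arrivals. *)
Lemma many_helpers (k m : nat) (s u : seq {fset nat}) S : #|` S| != k.-1 ->
  2 * m.+1 * m.+2 < 2 * total_aid k m.+1 S s ->
  m.+2 <= count (fun p => ~~ (p `<=` S)) (s ++ u).
Proof.
move=> Sk1; rewrite -mulnA ltn_pmul2l// => h; have h1 := total_aid_small_le m.+1 s Sk1.
rewrite count_cat; apply: leq_trans (leq_addr _ _).
by rewrite -(@leq_pmul2l m.+1)//; apply: leq_trans h1; exact: ltnW.
Qed.

End Arrivals.

(** * Change of the Lyapunov function along one outcome of a slot *)

Section Slot.
Local Open Scope fset_scope.
Local Open Scope nat_scope.
Variables (k A : nat).
Hypothesis k2 : 2 <= k.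

Local Notation C := (k * A).+1.
Local Notation L := (2 * (k * A).+1 * (k * A).+2).

Variables (s : seq {fset nat}) (cs : seq bool) (xs : seq {fset nat}).
Hypothesis sk : {in s, forall p, #|` p| < k}.
Hypothesis csA : size cs <= A.
Let new := arrivals (next_chunk s) cs.
Let t := s ++ new.
Hypothesis xt : size xs = size t.
Hypothesis t_grows : {in zip t xs, forall z, grows z.1 z.2}.

Lemma card_with_arrivals : {in t, forall p, #|` p| < k}.
Proof. by move=> p; rewrite mem_cat => /orP[/sk//|/card_arrivals]; lia. Qed.

Lemma missing_arrivals :
  missing k new = k.-1 * count id cs + k * count negb cs.
Proof.
by apply: sum_arrivals => [i|]; rewrite ?cardfs1 ?cardfs0; lia.
Qed.

Lemma missing_arrivals_le : missing k new <= k * A.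
Proof.
rewrite missing_arrivals; apply: leq_trans (_ : k * size cs <= _).
  by rewrite -count_negb mulnDr leq_add2r leq_mul2r; lia.
by rewrite leq_mul2l csA orbT.
Qed.

(** The discount varies by at most [L], whatever the club; this crude bound serves when useful
    contacts abound. *)
Lemma lyap_slot_gain :
  lyap k C L (kept k xs) + \sum_(z <- zip t xs) gain z.1 z.2
  <= lyap k C L s + k * A + L.
Proof.
have := missing_outcome xt t_grows card_with_arrivals.
have := missing_arrivals_le; rewrite /lyap missing_kept.
rewrite /t missing_cat -/t; lia.
Qed.

(** A fallback for the rare outcomes with strays or with massive departures from the club. *)
Lemma lyap_slot_moved S :
  lyap k C L (kept k xs) + \sum_(z <- zip t xs) moved S z.1 z.2
  <= lyap k C L s + k * A + L.
Proof.
have := missing_outcome_moved xt t_grows card_with_arrivals S.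
have := missing_arrivals_le; rewrite /lyap missing_kept.
rewrite /t missing_cat -/t; lia.
Qed.

Variable S : {fset nat}.
Hypothesis Ss : club S s.
Hypothesis no_stray : \sum_(z <- zip t xs) stray S z.1 z.2 = 0.
Hypothesis few_moved :
  size t + 2 * \sum_(z <- zip t xs) moved S z.1 z.2 < 2 * count_mem S t.

Let Sins : S \in s. Proof. exact: club_mem. Qed.
Let Sk : #|` S| < k. Proof. exact: sk. Qed.

(** A seeded newcomer adds [k.-1] to [missing] and [2 * k.-1] to the aid, an empty one [k] and
    [k.-1]; the downloads outside the club cancel between the two. The last count is compensated on
    average by the moved peers. *)
Lemma lyap_slot_large : #|` S| = k.-1 ->
  lyap k C L (kept k xs) + \sum_(z <- zip t xs) moved S z.1 z.2
    + k.-1 * count id cs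
  <= lyap k C L s + count negb cs + count (fun p => ~~ (p `<=` S)) t.
Proof.
move=> Sk1.
have h1 := missing_outcome_large xt t_grows card_with_arrivals no_stray Sk1.
have h2 := total_aid_outcome_large C xt t_grows card_with_arrivals no_stray Sk1.
have h3 := discount_outcome C L xt Sk few_moved.
have h4 := discount_le_club k C L Ss.
have h5 := total_aid_large_le C card_with_arrivals Sk1.
have h6 := discount_le k C L (kept k xs).
have h7 : total_aid k C S new = 2 * k.-1 * count id cs + k.-1 * count negb cs.
  apply: sum_arrivals => [i|]; rewrite /aid Sk1 eqxx.
    by rewrite fsub1set (negPf (fresh_notin i Sins)) cardfs1; lia.
  by rewrite fsub0set cardfs0; lia.
move: h1 h2 h3 h4 h5 h6 h7; rewrite /lyap missing_kept.
rewrite /t total_aid_cat missing_cat missing_arrivals -/new -/t => h1 h2 h3 h4 h5 h6 h7.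
move: h2 h5; rewrite h7 => h2 h5.
have kA1 : k.-1 * count id cs + k.-1 * count negb cs <= k * A.
  by rewrite -mulnDr count_negb leq_mul// leq_pred.
have kA2 : k.-1 <= k * A \/ count id cs + count negb cs = 0.
  rewrite count_negb; have [A0|A0] := posnP A; [right|left].
    by apply/eqP; rewrite -leqn0 -A0.
  by rewrite (leq_trans (leq_pred k))// leq_pmulr.
have kE : k * count negb cs = k.-1 * count negb cs + count negb cs by nia.
(* If the truncation is active after the slot, the aid of the newcomers may not be credited; but the
   aid then exceeds [L], and [h5] makes the peers outside the club numerous enough to make up for
   it. *)
have spread : L < total_aid k C S xs -> 2 * (k.-1 * count id cs) + k.-1 * count negb cs
    <= count (predC1 S) t + count (fun p => ~~ (p `<=` S)) t.
  move=> Lx; have k1 : 0 < k.-1 by lia.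
  rewrite -(leq_pmul2l k1); apply: leq_trans h5.
  apply: leq_trans (leq_trans (ltnW Lx) _); last by rewrite -h2; lia.
  case: kA2 => [kA2|/eqP]; last first.
    by rewrite addn_eq0 => /andP[/eqP -> /eqP ->]; rewrite !muln0.
  move: kA1 kA2; move: (k.-1 * count id cs) (k.-1 * count negb cs) (k * A) k.-1 => x y z w xyz wz.
  apply: leq_trans (_ : z * (2 * z) <= _); first by apply: leq_mul => //; lia.
  by nia.
move: spread h1 h2 h3 h4 h6; rewrite kE -!mulnA.
move: (total_aid _ _ _ xs) (total_aid _ _ _ s) (missing _ xs) (missing _ s).
move: (k.-1 * count id cs) (k.-1 * count negb cs).
move: (discount _ _ _ (kept _ _)) (discount _ _ _ s).
move: (count (predC1 S) t) (count (fun p => _) t) (count negb cs) (\sum_(z <- _) _).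
move: L; lia.
Qed.

(** A fresh chunk together with [S] makes at most [k.-1] chunks, so a seeded newcomer adds the full
    aid [C]; the bound [L / 2] on the previous aid leaves room for it below the truncation. *)
Lemma lyap_slot_small : #|` S| != k.-1 -> 2 * total_aid k C S s <= L ->
  lyap k C L (kept k xs) + \sum_(z <- zip t xs) moved S z.1 z.2
    + C * count id cs
  <= lyap k C L s + k.-1 * count id cs + k * count negb cs.
Proof.
move=> Sk1.
have h1 := missing_outcome_moved xt t_grows card_with_arrivals S.
have h2 := total_aid_outcome_small C xt t_grows no_stray Sk1.
have h3 := discount_outcome C L xt Sk few_moved.
have h4 := discount_le_club k C L Ss.
have h6 := discount_le k C L (kept k xs).
have h7 : total_aid k C S new = C * count id cs + 0 * count negb cs.
  apply: sum_arrivals => [i|]; rewrite /aid (negPf Sk1); last by rewrite fsub0set muln0.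
  rewrite fsub1set (negPf (fresh_notin i Sins)) cardfsU1 fresh_notin//=.
  by rewrite add1n -[X in _ < X](ltn_predK k2) ltnS ltn_neqAle Sk1 -ltnS (ltn_predK k2) Sk muln1.
have h8 : 2 * (C * count id cs) <= L.
  rewrite mulnA leq_mul//; apply: leq_trans (_ : size cs <= _).
    by rewrite -count_negb leq_addr.
  apply: leq_trans csA _; nia.
move: h1 h2 h3 h4 h6 h8; rewrite /lyap missing_kept.
rewrite /t total_aid_cat missing_cat missing_arrivals -/new -/t h7 -!mulnA.
move: (total_aid _ _ _ xs) (total_aid _ _ _ s) (missing _ xs) (missing _ s).
move: (k.-1 * count id cs) (k * count negb cs) (C * count id cs).
move: (discount _ _ _ (kept _ _)) (discount _ _ _ s) (\sum_(z <- _) _).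
move: L; lia.
Qed.

(** Aid is not lost here, so the discount does not decrease, and the arrivals add at most
    [k * A]. *)
Lemma lyap_slot_busy : #|` S| != k.-1 ->
  lyap k C L (kept k xs) + \sum_(z <- zip t xs) moved S z.1 z.2
  <= lyap k C L s + k * A.
Proof.
move=> Sk1.
have h1 := missing_outcome_moved xt t_grows card_with_arrivals S.
have h2 := total_aid_outcome_small C xt t_grows no_stray Sk1.
have h3 := discount_outcome C L xt Sk few_moved.
have h4 := discount_le_club k C L Ss.
have h6 := discount_le k C L (kept k xs).
have h7 := missing_arrivals_le.
move: h1 h2 h3 h4 h6 h7; rewrite /lyap missing_kept.
rewrite /t total_aid_cat missing_cat -/new -/t.
move: (total_aid _ _ _ xs) (total_aid _ _ _ s) (missing _ xs) (missing _ s).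
move: (total_aid _ _ _ new) (missing _ new).
move: (discount _ _ _ (kept _ _)) (discount _ _ _ s) (\sum_(z <- _) _).
move: L; lia.
Qed.

End Slot.

(** * Mean outcome of a slot in the presence of a club *)

Section ExpectedOutcome.
Local Open Scope fset_scope.
Local Open Scope ring_scope.
Context {R : realType}.
Implicit Types (p q S : {fset nat}) (s t xs : seq {fset nat}).

Lemma count_predC1 S t : (count_mem S t + count (predC1 S) t = size t)%N.
Proof. by rewrite -(count_predC (pred1 S) t). Qed.

(* The error term collects the events that some stray peer contacts another one,
   or that a fourth of all peers leave the club, of probability [O(1 / size t)]. *)
Lemma expect_club (S : {fset nat}) t (f : seq {fset nat} -> R) (X M b : R) :
  (1 < size t)%N -> 0 <= M -> (count (predC1 S) t)%:R <= b ->
  4 * b <= (size t)%:R -> 4 * M <= (size t)%:R ->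
  (forall xs, size xs = size t -> {in zip t xs, forall z, grows z.1 z.2} ->
    f xs + (\sum_(z <- zip t xs) moved S z.1 z.2)%N%:R <= X + M) ->
  (forall xs, size xs = size t -> {in zip t xs, forall z, grows z.1 z.2} ->
    (\sum_(z <- zip t xs) stray S z.1 z.2 = 0)%N ->
    (size t + 2 * \sum_(z <- zip t xs) moved S z.1 z.2 < 2 * count_mem S t)%N ->
    f xs + (\sum_(z <- zip t xs) moved S z.1 z.2)%N%:R <= X) ->
  let err := (b * (4 * M + b) + M * b ^+ 2) / (size t).-1%:R in
  expect (outcomes t) f <= X + err /\
  expect (outcomes t) f <= X - (count (fun p => ~~ (p `<=` S)) t)%:R + err.
Proof.
move=> t1 M0 tb b4 M4 always good err.
set U := fun xs => (\sum_(z <- zip t xs) moved S z.1 z.2)%N.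
set Z := fun xs => (\sum_(z <- zip t xs) stray S z.1 z.2)%N.
set N : R := (size t)%:R.
have N0 : 0 < N by rewrite ltr0n; lia.
have d0 : 0 < (size t).-1%:R :> R by rewrite ltr0n; lia.
have Nd : N = (size t).-1%:R + 1 by rewrite natr1 prednK//; lia.
have NS : (count_mem S t)%:R = N - (count (predC1 S) t)%:R.
  by rewrite /N -(count_predC1 S t) natrD addrK.
have b1b : (count (fun p => ~~ (p `<=` S)) t)%:R <= (count (predC1 S) t)%:R :> R.
  rewrite ler_nat; apply: sub_count => p /=; apply: contra => /eqP ->.
  exact: fsubset_refl.
(* A stray peer makes [M * Z] at least [M], and the departure of a quarter of all peers from the
   club does the same for [4 * M / N * U]; this covers the weaker bound [always]. *)
have pointwise xs : insupp (outcomes (R := R) t) xs ->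
    f xs <= X + M * (Z xs)%:R - (1 - 4 * M / N) * (U xs)%:R.
  move=> /(insupp_outcomes t1)[xt tg].
  have hZ : 0 <= M * (Z xs)%:R by rewrite mulr_ge0.
  have hU : 0 <= 4 * M / N * (U xs)%:R.
    by rewrite mulr_ge0// divr_ge0 ?(ltW N0)// mulr_ge0.
  have {}always := always xs xt tg; have {}good := good xs xt tg.
  rewrite -/(U xs) in always good; rewrite -/(Z xs) in good.
  have [Z0|Z0] := posnP (Z xs); last first.
    have : M * 1 <= M * (Z xs)%:R by rewrite ler_wpM2l// ler1n.
    by rewrite mulr1; lra.
  have [few|many] := ltnP (size t + 2 * U xs) (2 * count_mem S t).
    by have := good Z0 few; lra.
  (* At most a quarter of the peers are outside the club, since [4 * b <= N]; losing the majority
     thus takes the departure of another quarter. *)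
  have : N <= 4 * (U xs)%:R.
    move: many; rewrite -(ler_nat R) !natrM natrD natrM NS -/N.
    by move: tb b4; rewrite -/N; lra.
  move=> NU; have : M * 1 <= 4 * M / N * (U xs)%:R.
    by rewrite [leRHS](_ : _ = M * (4 * (U xs)%:R / N));
      [rewrite ler_wpM2l// ler_pdivlMr// mul1r|field; rewrite gt_eqF].
  by rewrite mulr1; lra.
have [nn _] := @proba_outcomes R t t1.
have EU : expect (outcomes t) (fun xs => (U xs)%:R) = (size t).-1%:R^-1 *
    ((N - (count (predC1 S) t)%:R) * (count (fun p => ~~ (p `<=` S)) t)%:R).
  by rewrite expect_sum_moved// natrM NS.
have EZ := @expect_sum_stray R t S t1; rewrite -/Z natrM in EZ.
have : expect (outcomes t) f <= X + M * expect (outcomes t) (fun xs => (Z xs)%:R)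
    - (1 - 4 * M / N) * expect (outcomes t) (fun xs => (U xs)%:R).
  apply: le_trans (le_expect nn pointwise) _.
  by rewrite expectB expectD !expectZ expect_cst//; exact: proba_outcomes.
rewrite {}EU; move: EZ; rewrite /err.
have -> : (size t).-1%:R = N - 1 by rewrite Nd addrK.
move: tb b1b {NS err}; set c := (count (predC1 S) t)%:R.
set b1 := (count (fun p => _) t)%:R => cb b1c.
have c0 : 0 <= c by exact: ler0n.
have b10 : 0 <= b1 by exact: ler0n.
rewrite -/N {}Nd in N0 b4 M4 *; move: (size t).-1%:R d0 N0 b4 M4 => d d0 N0 b4 M4.
move: (expect _ f) (expect _ _) => E EZ hZ hE; rewrite addrK in hZ hE *.
have b0 : 0 <= b by exact: le_trans cb.
have h1 : M * EZ <= M * b ^+ 2 / d.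
  rewrite -mulrA ler_wpM2l//; apply: le_trans hZ _.
  by rewrite mulrC ler_pM2r ?invr_gt0// -expr2 ler_pXn2r// nnegrE.
have x1 : 4 * M / (d + 1) <= 1 by rewrite ler_pdivrMr// mul1r.
have x0 : 0 <= 4 * M / (d + 1) by rewrite divr_ge0 ?(ltW N0)// mulr_ge0.
have cd : c <= d + 1 by lra.
(* Dropping the departures gives the first bound; [h3], where their mean is [b1] up to order
   [1 / d], gives the second. *)
have h2 : 0 <= (1 - 4 * M / (d + 1)) * (d^-1 * ((d + 1 - c) * b1)).
  rewrite mulr_ge0 ?subr_ge0// mulr_ge0 ?invr_ge0 ?(ltW d0)// mulr_ge0// subr_ge0//.
have h3 : b1 - b * (4 * M + b) / d <=
    (1 - 4 * M / (d + 1)) * (d^-1 * ((d + 1 - c) * b1)).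
  apply: (@le_trans _ _ (b1 - b1 * (4 * M + b) / d)).
    rewrite lerD2l lerN2 ler_pM2r ?invr_gt0// ler_wpM2r ?(le_trans b1c)//.
    by rewrite addr_ge0// mulr_ge0.
  have -> : b1 - b1 * (4 * M + b) / d = (d - (4 * M + b)) * (b1 / d).
    by field; rewrite gt_eqF.
  have -> : (1 - 4 * M / (d + 1)) * (d^-1 * ((d + 1 - c) * b1)) =
     (d + 1 - c - 4 * M + 4 * M / (d + 1) * c) * (b1 / d).
    by field; rewrite !gt_eqF.
  rewrite ler_wpM2r ?divr_ge0 ?(ltW d0)//.
  have : 0 <= 4 * M / (d + 1) * c by rewrite mulr_ge0.
  by lra.
have -> : (b * (4 * M + b) + M * b ^+ 2) / d = b * (4 * M + b) / d + M * b ^+ 2 / d.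
  by rewrite mulrDl.
have h4 : 0 <= b * (4 * M + b) / d.
  by rewrite divr_ge0 ?(ltW d0)// mulr_ge0// addr_ge0// mulr_ge0.
by split; lra.
Qed.

End ExpectedOutcome.

(** * Drift *)

Section SlotExpectation.
Local Open Scope fset_scope.
Local Open Scope ring_scope.
Context {R : realType}.
Variables (k A : nat) (a : nat -> R) (lambda : R).
Hypothesis a_ge0 : forall n, 0 <= a n.
Hypothesis a_supp : forall n, a n != 0 -> (1 < n < A)%N.
Hypothesis a_sum : \sum_(n < A) a n = 1.
Hypothesis a_mean : \sum_(n < A) n%:R * a n = lambda.
Hypothesis lambda_gt1 : 1 < lambda.
Implicit Types (s : config k).

Local Notation slot := (@slot R k A a lambda).

Let lambda_gt0 : 0 < lambda. Proof. exact: lt_trans lambda_gt1. Qed.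

Lemma sum_iota_ord (F : nat -> R) n : \sum_(i <- iota 0 n) F i = \sum_(i < n) F i.
Proof. by rewrite -(big_mkord xpredT F) /index_iota subn0. Qed.

Lemma proba_arrival_number : proba (arrival_number A a).
Proof.
split; first by move=> w /mapP[n _ ->]; exact: a_ge0.
by rewrite big_map sum_iota_ord.
Qed.

Lemma expect_arrival_number f :
  expect (arrival_number A a) f = \sum_(n < A) a n * f n.
Proof. by rewrite /expect big_map (sum_iota_ord (fun n => a n * f n)). Qed.

Lemma insupp_arrival_number n : insupp (arrival_number A a) n -> (1 < n < A)%N.
Proof.
by move=> [r r0 /mapP[m _ [rE nE]]]; apply: a_supp; rewrite nE -rE gt_eqF.
Qed.

Lemma proba_coin : proba (coin lambda).
Proof.
split.
  move=> w; rewrite !inE => /orP[/eqP ->|/eqP ->] /=; first by rewrite divr_ge0 ?(ltW lambda_gt0).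
  by rewrite divr_ge0 ?(ltW lambda_gt0)// subr_ge0 ltW.
by rewrite big_cons big_seq1/=; field; rewrite gt_eqF.
Qed.

Definition coins n : dist R (seq bool) := dindep (nseq n (coin lambda)).

Let coinsE n : coins n = dindep [seq coin lambda | _ <- nseq n tt].
Proof. by rewrite /coins map_nseq. Qed.

Lemma proba_coins n : proba (coins n).
Proof. by rewrite coinsE; apply: proba_indep => _ _; exact: proba_coin. Qed.

Lemma insupp_coins n cs : insupp (coins n) cs -> size cs = n.
Proof.
rewrite coinsE => /insupp_indep[|-> _]; last exact: size_nseq.
by move=> _ _; exact: proba_coin.
Qed.

Lemma expect_coins_count n (e : pred bool) :
  expect (coins n) (fun cs => (count e cs)%:R) =
  n%:R * expect (coin lambda) (fun b => (e b)%:R).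
Proof.
transitivity (expect (coins n)
    (fun cs => \sum_(z <- zip (nseq n tt) cs) (e z.2)%:R)).
  apply: eq_expect => [|cs /insupp_coins csn]; first exact: (proba_coins n).1.
  rewrite -natr_count -(big_map snd xpredT (fun b => (e b)%:R)).
  by rewrite -/(unzip2 _) unzip2_zip// size_nseq csn.
rewrite coinsE (expect_indep_sum (fun _ b => (e b)%:R)); last first.
  by move=> _ _; exact: proba_coin.
by rewrite big_nseq iter_addr addr0 mulr_natl.
Qed.

Lemma expect_coin_id : expect (coin lambda) (fun b => (id b)%:R) = lambda^-1.
Proof. by rewrite /expect big_cons big_seq1/= mulr1 mulr0 addr0 div1r. Qed.

Lemma expect_coin_negb :
  expect (coin lambda) (fun b => (negb b)%:R) = (lambda - 1) / lambda.
Proof. by rewrite /expect big_cons big_seq1/= mulr1 mulr0 add0r. Qed.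

Definition after_arrivals s cs : seq {fset nat} :=
  profiles s ++ arrivals (next_chunk (profiles s)) cs.

Lemma expect_slot s f : expect (slot s) f =
  expect (arrival_number A a) (fun n => expect (coins n) (fun cs =>
    expect (outcomes (after_arrivals s cs)) (fun xs => f (pmap insub xs : config k)))).
Proof.
rewrite /slot /with_arrivals !expect_bind; apply: eq_expect_fun => n.
rewrite expect_bind; apply: eq_expect_fun => cs.
rewrite expect_ret expect_bind; apply: eq_expect_fun => xs.
by rewrite expect_ret.
Qed.

Lemma size_after_arrivals s cs : size (after_arrivals s cs) = (size s + size cs)%N.
Proof. by rewrite size_cat size_arrivals size_map. Qed.

Lemma proba_slot s : proba (slot s).
Proof.
rewrite /slot /with_arrivals; apply: proba_bind.
  apply: proba_bind => [|n _]; first exact: proba_arrival_number.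
  by apply: proba_bind => [|cs _]; [exact: proba_coins|exact: proba_ret].
move=> t /insupp_bind[|n /insupp_arrival_number/andP[n1 nA]].
  exact: proba_arrival_number.1.
move=> /insupp_bind[|cs /insupp_coins csn /insupp_ret ->].
  exact: (proba_coins n).1.
apply: proba_bind => [|xs _]; last exact: proba_ret.
by apply: proba_outcomes; rewrite size_after_arrivals csn (leq_trans n1)// leq_addl.
Qed.

Lemma profiles_pmap_insub xs : profiles (pmap insub xs : config k) = kept k xs.
Proof.
rewrite /profiles /kept (pmap_filter (insubK _)).
by apply: eq_filter => p; rewrite /= isSome_insub.
Qed.

Lemma card_profiles s : {in profiles s, forall p, (#|` p| < k)%N}.
Proof. by move=> p /mapP[q _ ->]; exact: valP q. Qed.

(* The mean numbers of seeded and of empty newcomers are [1] and [lambda - 1]. *)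
Lemma expect_slot_le s f (al be ga : R) :
  (forall n cs, (1 < n < A)%N -> size cs = n ->
    expect (outcomes (after_arrivals s cs)) (fun xs => f (pmap insub xs : config k))
    <= al + be * (count id cs)%:R + ga * (count negb cs)%:R) ->
  expect (slot s) f <= al + be + ga * (lambda - 1).
Proof.
move=> h; rewrite expect_slot.
apply: (@le_trans _ _ (expect (arrival_number A a) (fun n =>
   al + (be * lambda^-1 + ga * ((lambda - 1) / lambda)) * n%:R))).
  apply: le_expect => [|n /insupp_arrival_number n1A]; first exact: proba_arrival_number.1.
  apply: (@le_trans _ _ (expect (coins n) (fun cs =>
      al + be * (count id cs)%:R + ga * (count negb cs)%:R))).
    apply: le_expect => [|cs /insupp_coins csn]; first exact: (proba_coins n).1.
    exact: h csn.
  rewrite !expectD !expectZ !expect_coins_count expect_coin_id expect_coin_negb.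
  by rewrite expect_cst; [rewrite le_eqVlt; apply/orP; left; apply/eqP; ring|exact: proba_coins].
rewrite expectD expectZ expect_cst; last exact: proba_arrival_number.
rewrite expect_arrival_number (_ : \sum_(n < A) _ = lambda); last first.
  by rewrite -a_mean; apply: eq_bigr => n _; rewrite mulrC.
by rewrite le_eqVlt; apply/orP; left; apply/eqP; field; rewrite gt_eqF.
Qed.

End SlotExpectation.

(** * Negative drift for large populations *)

Section Drift.
Local Open Scope fset_scope.
Local Open Scope ring_scope.
Context {R : realType}.
Variables (k A : nat) (a : nat -> R) (lambda : R).
Hypothesis a_ge0 : forall n, 0 <= a n.
Hypothesis a_supp : forall n, a n != 0 -> (1 < n < A)%N.
Hypothesis a_sum : \sum_(n < A) a n = 1.
Hypothesis a_mean : \sum_(n < A) n%:R * a n = lambda.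
Hypothesis lambda_gt1 : 1 < lambda.
Hypothesis lambda_ltk : lambda < k%:R.
Implicit Types (s : config k).

Local Notation slot := (@slot R k A a lambda).
(* [k * A] bounds the increase of [missing] in a slot.  [C] and [L] are such that it
   is compensated by one seeded newcomer in the mean, and by the peers that provide
   an aid above [L]; [B / 4] useful contacts compensate for it and for the loss of
   the discount [L]. *)
Local Notation C := (k * A).+1.
Local Notation L := (2 * (k * A).+1 * (k * A).+2)%N.
Local Notation B := (4 * (k * A + L + 2))%N.
Local Notation M := (k * A + L + C * A)%N.
Local Notation Bm := (B + A)%N.

Definition potential s : R := (lyap k C L (profiles s))%:R.

Let k2 : (2 <= k)%N.
Proof. by have := lt_trans lambda_gt1 lambda_ltk; rewrite ltr1n. Qed.

Lemma lambda_leA : lambda <= A%:R.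
Proof.
rewrite -a_mean -[leRHS]mulr1 -[X in _ <= _ * X]a_sum mulr_sumr; apply: ler_sum => n _.
by rewrite ler_wpM2r// ler_nat ltnW.
Qed.

Lemma potential_pmap_insub xs : potential (pmap insub xs) = (lyap k C L (kept k xs))%:R.
Proof. by rewrite /potential profiles_pmap_insub. Qed.

Section Arrived.
Variables (s : config k) (cs : seq bool).
Hypothesis csn : (1 < size cs < A)%N.
Let t := after_arrivals s cs.

Let t1 : (1 < size t)%N.
Proof. by case/andP: csn => c1 _; rewrite size_after_arrivals (leq_trans c1)// leq_addl. Qed.

Let csA : (size cs <= A)%N. Proof. by case/andP: csn => _ /ltnW. Qed.

Let sk := @card_profiles k s.

Lemma expect_gain_arrived :
  expect (outcomes t) (fun xs => potential (pmap insub xs)) <=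
  potential s + (k * A + L)%:R -
  (size t).-1%:R^-1 * (\sum_(p <- t) count (fun q => ~~ (q `<=` p)) t)%N%:R.
Proof.
rewrite -expect_sum_gain// -[X in X - _](expect_cst _ (proba_outcomes t1)) -expectB.
apply: le_expect => [|xs /(insupp_outcomes t1)[xt tg]]; first exact: (proba_outcomes t1).1.
rewrite potential_pmap_insub lerBrDr -!natrD ler_nat addnA.
exact: lyap_slot_gain.
Qed.

Lemma potential_slot_bounded :
  expect (outcomes t) (fun xs => potential (pmap insub xs)) <=
  potential s + (k * A + L)%:R.
Proof.
apply: le_trans expect_gain_arrived _; rewrite gerBl.
by rewrite mulr_ge0 ?invr_ge0.
Qed.

(** Of two peers with different profiles, at least one is useful to the other; this gives at least
    [size s * B / 2] useful ordered pairs. *)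
Lemma drift_far : (forall p, p \in profiles s ->
    (B <= count (predC1 p) (profiles s))%N) -> (A < size s)%N ->
  expect (outcomes t) (fun xs => potential (pmap insub xs)) <= potential s - 2.
Proof.
move=> far As; apply: le_trans expect_gain_arrived _.
have sum_ge : (size s * B <= 2 * \sum_(p <- t) count (fun q => ~~ (q `<=` p)) t)%N.
  have -> : (2 * \sum_(p <- t) count (fun q => ~~ (q `<=` p)) t =
      \sum_(p <- t) \sum_(q <- t) (~~ (q `<=` p) + ~~ (p `<=` q)))%N.
    rewrite mul2n -addnn; under eq_bigr do rewrite -sumb_count.
    rewrite [X in (_ + X)%N]exchange_big -big_split/=.
    by apply: eq_bigr => p _; rewrite big_split.
  apply: (@leq_trans (\sum_(p <- t) \sum_(q <- t) (q != p))%N); last first.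
    apply: leq_sum => p _; apply: leq_sum => q _.
    by rewrite eqEfsubset; case: (q `<=` p); case: (p `<=` q).
  rewrite /t /after_arrivals big_cat/=; apply: leq_trans (leq_addr _ _).
  have -> : (size s * B = \sum_(p <- profiles s) B)%N.
    by rewrite big_const_seq count_predT iter_addn_0 mulnC size_map.
  rewrite big_seq [leqRHS]big_seq; apply: leq_sum => p ps.
  apply: leq_trans (far p ps) _; rewrite -sumb_count big_cat/=.
  exact: leq_addr.
set G := (\sum_(p <- t) _)%N in sum_ge *.
have d0 : 0 < (size t).-1%:R :> R by rewrite ltr0n; move: t1; case: (size t) => [|[]].
(* Newcomers at most double the population, so the mean gain is at least [B / 4]. *)
have td : (size t).-1%:R <= 2 * (size s)%:R :> R.
  rewrite -natrM ler_nat size_after_arrivals; move: As csA; lia.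
suff : (k * A + L + 2)%:R <= (size t).-1%:R^-1 * G%:R :> R by rewrite natrD; lra.
rewrite mulrC ler_pdivlMr//.
apply: le_trans (_ : (k * A + L + 2)%:R * (2 * (size s)%:R) <= _).
  by rewrite ler_wpM2l.
rewrite -!natrM ler_nat -(@leq_pmul2l 2)//.
by apply: leq_trans sum_ge; rewrite [leqLHS](_ : _ = size s * B)%N//; ring.
Qed.


Section Near.
Variable S : {fset nat}.
Hypothesis Ss : S \in profiles s.
Hypothesis near : (count (predC1 S) (profiles s) <= B)%N.
Hypothesis s_large : (4 * (M + Bm) <= size s)%N.

Let err : R := (Bm%:R * (4 * M%:R + Bm%:R) + M%:R * Bm%:R ^+ 2) / (size t).-1%:R.

Let clubS : club S (profiles s).
Proof.
rewrite /club; have := count_predC1 S (profiles s); rewrite size_map.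
move: s_large near => /=; lia.
Qed.

Let strayS : (count (predC1 S) t)%:R <= Bm%:R :> R.
Proof.
rewrite ler_nat count_cat leq_add//; apply: leq_trans (count_size _ _) _.
by rewrite size_arrivals.
Qed.

Let t_large : (size s <= size t)%N.
Proof. by rewrite size_after_arrivals leq_addr. Qed.

Let t_Bm : 4 * Bm%:R <= (size t)%:R :> R.
Proof.
by rewrite -natrM ler_nat; apply: leq_trans t_large; apply: leq_trans s_large; lia.
Qed.

Let t_M : 4 * M%:R <= (size t)%:R :> R.
Proof.
by rewrite -natrM ler_nat; apply: leq_trans t_large; apply: leq_trans s_large; lia.
Qed.

Lemma drift_large : #|` S| = k.-1 ->
  expect (outcomes t) (fun xs => potential (pmap insub xs)) <=
  potential s + err - k.-1%:R * (count id cs)%:R + (count negb cs)%:R.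
Proof.
move=> Sk.
pose b1 := count (fun p => ~~ (p `<=` S)) t.
(* In the second bound of [expect_club] the term [- b1] cancels the [b1] put into [X]. *)
have [||_] := expect_club (f := fun xs => potential (pmap insub xs))
  (X := potential s - k.-1%:R * (count id cs)%:R + (count negb cs)%:R + b1%:R)
  t1 (ler0n _ M) strayS t_Bm t_M.
- move=> xs xt tg.
  have h := lyap_slot_moved k2 sk csA xt tg S.
  rewrite potential_pmap_insub /potential.
  have h1 : (k.-1 * count id cs <= C * A)%N.
    apply: leq_mul; last by rewrite (leq_trans (count_size _ _)).
    by move: csA csn; nia.
  have {h1}h : (lyap k C L (kept k xs) + \sum_(z <- zip t xs) moved S z.1 z.2
      + k.-1 * count id cs <= lyap k C L (profiles s) + M)%N.
    move: h h1; rewrite -/(after_arrivals s cs) -/t.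
    move: (lyap _ _ _ _) (lyap _ _ _ _); move: (\sum_(z <- _) _)%N (_.-1 * _)%N (C * A)%N L.
    lia.
  have := ler0n R (count negb cs); have := ler0n R b1; move: h.
  move: (lyap _ _ _ _) (lyap _ _ _ _) => v w; move: (\sum_(z <- _) _)%N M (count negb cs) => u m n2.
  rewrite -(ler_nat R) !natrD natrM; lra.
- move=> xs xt tg st mv.
  have h := lyap_slot_large k2 sk csA xt tg clubS st mv Sk.
  rewrite potential_pmap_insub /potential.
  move: h; rewrite -/(after_arrivals s cs) -/t -/b1.
  move: (lyap _ _ _ _) (lyap _ _ _ _) => v w; move: (\sum_(z <- _) _)%N (count negb cs) b1 => u n2 b.
  rewrite -(ler_nat R) !natrD natrM; lra.
rewrite -/b1 /err; lra.
Qed.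

Lemma drift_small : #|` S| != k.-1 ->
  (2 * total_aid k C S (profiles s) <= L)%N ->
  expect (outcomes t) (fun xs => potential (pmap insub xs)) <=
  potential s + err + (k.-1%:R - C%:R) * (count id cs)%:R + k%:R * (count negb cs)%:R.
Proof.
move=> Sk aidL.
(* The seeded newcomers bring the decrease, so the first bound of [expect_club] suffices. *)
have [||+ _] := expect_club (f := fun xs => potential (pmap insub xs))
  (X := potential s + (k.-1%:R - C%:R) * (count id cs)%:R + k%:R * (count negb cs)%:R)
  t1 (ler0n _ M) strayS t_Bm t_M.
- move=> xs xt tg.
  have h := lyap_slot_moved k2 sk csA xt tg S.
  rewrite potential_pmap_insub /potential.
  have h1 : (C * count id cs <= C * A)%N.
    by apply: leq_mul => //; rewrite (leq_trans (count_size _ _)).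
  have {h1}h : (lyap k C L (kept k xs) + \sum_(z <- zip t xs) moved S z.1 z.2
      + C * count id cs <= lyap k C L (profiles s) + M)%N.
    move: h h1; rewrite -/(after_arrivals s cs) -/t.
    move: (lyap _ _ _ _) (lyap _ _ _ _); move: (\sum_(z <- _) _)%N (C * count _ _)%N (C * A)%N L.
    lia.
  have := mulr_ge0 (ler0n R k.-1) (ler0n R (count id cs)).
  have := mulr_ge0 (ler0n R k) (ler0n R (count negb cs)).
  move: h; rewrite mulrBl.
  move: (lyap _ _ _ _) (lyap _ _ _ _) => v w; move: (\sum_(z <- _) _)%N M C => u m c.
  rewrite -(ler_nat R) !natrD natrM; lra.
- move=> xs xt tg st mv.
  have h := lyap_slot_small k2 sk csA xt tg clubS st mv Sk aidL.
  rewrite potential_pmap_insub /potential mulrBl.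
  move: h; rewrite -/(after_arrivals s cs) -/t.
  move: (lyap _ _ _ _) (lyap _ _ _ _) => v w; move: (\sum_(z <- _) _)%N C => u c.
  rewrite -(ler_nat R) !natrD !natrM; lra.
rewrite /err; lra.
Qed.

Lemma drift_busy : #|` S| != k.-1 ->
  (L < 2 * total_aid k C S (profiles s))%N ->
  expect (outcomes t) (fun xs => potential (pmap insub xs)) <= potential s + err - 2.
Proof.
move=> Sk aidL.
pose b1 := count (fun p => ~~ (p `<=` S)) t.
have [||_] := expect_club (f := fun xs => potential (pmap insub xs))
  (X := potential s + (k * A)%:R) t1 (ler0n _ M) strayS t_Bm t_M.
- move=> xs xt tg.
  have h := lyap_slot_moved k2 sk csA xt tg S.
  rewrite potential_pmap_insub /potential.
  have {}h : (lyap k C L (kept k xs) + \sum_(z <- zip t xs) moved S z.1 z.2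
      <= lyap k C L (profiles s) + k * A + M)%N.
    move: h; rewrite -/(after_arrivals s cs) -/t.
    move: (lyap _ _ _ _) (lyap _ _ _ _); move: (\sum_(z <- _) _)%N (C * A)%N L.
    lia.
  by move: h; rewrite -(ler_nat R) natrD (natrD _ _ M) natrD.
- move=> xs xt tg st mv.
  have h := lyap_slot_busy k2 sk csA xt tg clubS st mv Sk.
  rewrite potential_pmap_insub /potential.
  by move: h; rewrite -(ler_nat R) natrD (natrD _ _ (k * A)).
(* Up to [err], the helpers make on average at least [k * A + 2] members leave the club, against an
   increase of at most [k * A]. *)
have : (k * A).+2%:R <= b1%:R :> R by rewrite ler_nat; exact: many_helpers Sk aidL.
rewrite -/b1 /err -addn2 natrD; lra.
Qed.

End Near.
End Arrived.
Lemma slot_bounded s :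
  expect (slot s) potential <= potential s + (k * A + L)%:R.
Proof.
have := @expect_slot_le R k A a lambda a_ge0 a_supp a_sum a_mean lambda_gt1 s
  potential (potential s + (k * A + L)%:R) 0 0.
rewrite mul0r !addr0; apply=> n cs nA csn; rewrite !mul0r !addr0.
by apply: potential_slot_bounded; rewrite csn.
Qed.

Lemma drift : exists (N0 : nat) (eps : R), 0 < eps /\
  forall s, (N0 <= size s)%N -> expect (slot s) potential <= potential s - eps.
Proof.
(* The margin [k - lambda] of the case [#|S| = k - 1], capped by [1] for the other cases; half of it
   pays for the error term. *)
pose kap := Num.min (k%:R - lambda) 1.
have kap0 : 0 < kap by rewrite lt_min subr_gt0 lambda_ltk ltr01.
pose E0 : R := Bm%:R * (4 * M%:R + Bm%:R) + M%:R * Bm%:R ^+ 2.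
have E00 : 0 <= E0 by rewrite addr_ge0 ?mulr_ge0 ?addr_ge0 ?exprn_ge0.
pose N1 := Num.truncn (2 * E0 / kap).
exists (4 * (M + Bm) + A.+1 + N1.+1)%N, (kap / 2); split; first by rewrite divr_gt0.
move=> s sN.
have sM : (4 * (M + Bm) <= size s)%N by apply: leq_trans sN; apply: leq_trans (leq_addr _ _); exact: leq_addr.
have sA : (A < size s)%N.
  by apply: leq_trans sN; apply: leq_trans (leq_addr _ _); exact: leq_addl.
have sN1 : (N1 < size s)%N by apply: leq_trans sN; exact: leq_addl.
have err_le cs : (1 < size cs)%N -> E0 / (size (after_arrivals s cs)).-1%:R <= kap / 2.
  move=> cs1; have d0 : (size s <= (size (after_arrivals s cs)).-1)%N.
    by rewrite size_after_arrivals; move: cs1; lia.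
  have d1 : 0 < (size (after_arrivals s cs)).-1%:R :> R.
    by rewrite ltr0n (leq_trans _ d0)// (leq_trans _ sA).
  have : 2 * E0 / kap <= (size (after_arrivals s cs)).-1%:R.
    apply: (@le_trans _ _ N1.+1%:R); first by apply/ltW; exact: truncnS_gt.
    by rewrite ler_nat (leq_trans sN1).
  by rewrite !ler_pdivrMr//; move: (_.-1%:R) => d; lra.
have kapl : kap <= k%:R - lambda by rewrite ge_min lexx.
have kap1 : kap <= 1 by rewrite ge_min lexx orbT.
have slot_le := @expect_slot_le R k A a lambda a_ge0 a_supp a_sum a_mean lambda_gt1 s
  potential.
have [[S Ss Sn]|nS] := pselect (exists2 S, S \in profiles s &
    (count (predC1 S) (profiles s) <= B)%N); last first.
  have := slot_le (potential s - 2) 0 0.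
  rewrite mul0r !addr0 => h; apply: le_trans (h _) _; last by lra.
  move=> n cs nA csn; rewrite !mul0r !addr0.
  apply: drift_far; rewrite ?csn// => p ps; rewrite leqNgt; apply/negP => pB.
  by apply: nS; exists p => //; exact: ltnW.
have [Sk|Sk] := eqVneq #|` S| k.-1.
  have := slot_le (potential s + kap / 2) (- k.-1%:R) 1 => h.
  apply: le_trans (h _) _.
    move=> n cs nA csn; rewrite mulNr mul1r.
    have csA : (1 < size cs < A)%N by rewrite csn.
    apply: le_trans (drift_large csA Ss Sn sM Sk) _.
    rewrite -/E0; have := err_le cs; case/andP: csA => -> _ /(_ isT); lra.
  (* The mean change is at most [kap / 2 - k.-1 + (lambda - 1)], that is
     [kap / 2 - (k - lambda)]. *)
  have -> : k.-1%:R = k%:R - 1 :> R by rewrite -subn1 natrB// ltnW.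
  by lra.
have [aL|aL] := leqP (2 * total_aid k C S (profiles s)) L.
  have := slot_le (potential s + kap / 2) (k.-1%:R - C%:R) k%:R => h.
  apply: le_trans (h _) _.
    move=> n cs nA csn.
    have csA : (1 < size cs < A)%N by rewrite csn.
    apply: le_trans (drift_small csA Ss Sn sM Sk aL) _.
    rewrite -/E0; have := err_le cs; case/andP: csA => -> _ /(_ isT); lra.
  have -> : k.-1%:R = k%:R - 1 :> R by rewrite -subn1 natrB// ltnW.
  have -> : C%:R = k%:R * A%:R + 1 :> R by rewrite -natr1 natrM.
  (* The mean change is at most [kap / 2 + k * (lambda - A) - 2], where [lambda <= A]. *)
  have := ler_wpM2l (ler0n R k) lambda_leA; lra.
have := slot_le (potential s + kap / 2 - 2) 0 0.
rewrite mul0r !addr0 => h; apply: le_trans (h _) _; last by lra.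
move=> n cs nA csn; rewrite !mul0r !addr0.
have csA : (1 < size cs < A)%N by rewrite csn.
apply: le_trans (drift_busy csA Ss Sn sM Sk aL) _.
rewrite -/E0; have := err_le cs; case/andP: csA => -> _ /(_ isT); lra.
Qed.

End Drift.

(** * Renewal *)

Section Rename.
Local Open Scope fset_scope.
Local Open Scope nat_scope.
Implicit Types (p q S : {fset nat}) (s t : seq {fset nat}) (f : nat -> nat).

Lemma card_rename f p : injective f -> #|` rename f p| = #|` p|.
Proof. by move=> fi; rewrite card_imfset. Qed.

Lemma mem_rename f p c : injective f -> (f c \in rename f p) = (c \in p).
Proof. by move=> fi; rewrite mem_imfset. Qed.

Lemma fsub_rename f p q : injective f -> (rename f p `<=` rename f q) = (p `<=` q).
Proof.
move=> fi; apply/fsubsetP/fsubsetP => pq c; last first.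
  by move=> /imfsetP[d /= /pq dq ->]; rewrite mem_rename.
by move=> cp; rewrite -(mem_rename _ _ fi) pq// mem_rename.
Qed.

Lemma rename_inj f : injective f -> injective (rename f).
Proof.
move=> fi p q pq; apply/eqP; rewrite eqEfsubset.
by rewrite -(fsub_rename p q fi) -(fsub_rename q p fi) pq fsubset_refl.
Qed.

Lemma renameU f p q : rename f (p `|` q) = rename f p `|` rename f q.
Proof. exact: imfsetU. Qed.

Lemma rename1 f c : rename f [fset c] = [fset f c].
Proof. exact: imfset_fset1. Qed.

Lemma renameU1 f c p : rename f (c |` p) = f c |` rename f p.
Proof. by rewrite renameU rename1. Qed.

Lemma eq_in_rename f g p : {in p, f =1 g} -> rename f p = rename g p.
Proof.
move=> fg; apply/fsetP => c; apply/imfsetP/imfsetP => -[d /= dp ->]; exists d => //=.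
  exact: fg.
by rewrite fg.
Qed.

Lemma kept_rename k f t : injective f ->
  kept k (map (rename f) t) = map (rename f) (kept k t).
Proof.
move=> fi; rewrite /kept filter_map; congr map; apply: eq_filter => p /=.
by rewrite card_rename.
Qed.

Section Lyap.
Variables (k C L : nat).

Lemma aid_rename f S p : injective f -> aid k C (rename f S) (rename f p) = aid k C S p.
Proof. by move=> fi; rewrite /aid -renameU !card_rename// fsub_rename. Qed.

Lemma total_aid_rename f S t : injective f ->
  total_aid k C (rename f S) (map (rename f) t) = total_aid k C S t.
Proof. by move=> fi; rewrite /total_aid big_map; apply: eq_bigr => p _; rewrite aid_rename. Qed.

Lemma club_rename f S t : injective f ->
  club (rename f S) (map (rename f) t) = club S t.
Proof.
move=> fi; rewrite /club size_map count_map; congr (_ < 2 * _).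
by apply: eq_count => p /=; rewrite (inj_eq (rename_inj fi)).
Qed.

Lemma lyap_rename f t : injective f -> lyap k C L (map (rename f) t) = lyap k C L t.
Proof.
move=> fi; rewrite /lyap; congr (_ + (_ - _)).
  by rewrite /missing big_map; apply: eq_bigr => p _; rewrite card_rename.
rewrite /discount big_map; apply: eq_big => [S|S _]; first exact: club_rename.
by rewrite total_aid_rename.
Qed.

Lemma lyap_perm s t : perm_eq s t -> lyap k C L s = lyap k C L t.
Proof.
move=> st; rewrite /lyap; congr (_ + (_ - _)); first exact: perm_big.
rewrite /discount (perm_big _ st); apply: eq_big => [S|S _].
  by rewrite /club (perm_size st) (permP st).
by rewrite /total_aid (perm_big _ st).
Qed.

End Lyap.

(** This makes the Lyapunov function well defined on the quotient. *)
Lemma lyap_same k C L (s t : config k) : same_collection s t ->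
  lyap k C L (profiles s) = lyap k C L (profiles t).
Proof.
move=> /asboolP[f [g fK gK] /lyap_perm <-].
by rewrite lyap_rename//; exact: can_inj fK.
Qed.

Lemma size_same k (s t : config k) : same_collection s t -> size s = size t.
Proof. by move=> /asboolP[f _ /perm_size]; rewrite !size_map. Qed.

Definition swap (b c i : nat) : nat := if i == b then c else if i == c then b else i.

Lemma swapK b c : involutive (swap b c).
Proof.
move=> i; rewrite /swap; case: (eqVneq i b) => [->|ib].
  by rewrite eqxx; case: eqP => [->|].
by case: (eqVneq i c) => [->|ic]; rewrite ?eqxx// (negPf ib) (negPf ic).
Qed.

(* A map injective on [l] is corrected point by point by transpositions. *)
Lemma extend_injective (l : seq nat) (g : nat -> nat) : {in l &, injective g} ->
  exists2 f : nat -> nat, bijective f & {in l, f =1 g}.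
Proof.
elim: l => [|x l IH] gi; first by exists id => //; exists id.
have [|f bf fg] := IH.
  by move=> i j il jl; apply: gi; rewrite inE ?il ?jl orbT.
have [xl|xl] := boolP (x \in l).
  by exists f => // i; rewrite inE => /predU1P[->|]; exact: fg.
exists (swap (f x) (g x) \o f).
  apply: bij_comp => //; exists (swap (f x) (g x)); exact: swapK.
move=> i; rewrite inE => /predU1P[->|il] /=; first by rewrite /swap eqxx.
have ix : i != x by apply: contraNneq xl => <-.
rewrite /swap (inj_eq (bij_inj bf)) (negPf ix) fg//.
case: eqP => // gix; move/eqP: ix => []; apply: gi => //; rewrite inE ?eqxx ?il ?orbT//.
Qed.

End Rename.

(** * A sequence of slots that forgets the initial state *)

Section Renewal.
Local Open Scope fset_scope.
Local Open Scope nat_scope.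
Variables (k n0 : nat).
Hypothesis n0_gt1 : 1 < n0.
Hypothesis k_gt0 : 0 < k.
Implicit Types (p q S : {fset nat}) (s : config k) (t : seq {fset nat}) (f : nat -> nat).

Definition newcomer m i := (if i == 0 then m.+1 else m) |` [fset m + i].

(* The chosen outcome of a slot: all [n0] newcomers are seeded, each peer gets a
   chunk of the first newcomer, which itself gets a chunk of the second one. *)
Definition renewal m t :=
  [seq m |` p | p <- t] ++ [seq newcomer m i | i <- iota 0 n0].

(* What is left of the newcomers of the last [j] slots, in canonical names. *)
Fixpoint recent j : seq {fset nat} :=
  if j is i.+1 then kept k (renewal (i * n0) (recent i)) else [::].

(** [old] stands for the peers present before the last [j] slots, which received a chunk in each of
    them; [f] translates the canonical names. *)
Definition renewed j s : Prop := exists old f,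
  [/\ bijective f, all (fun p => j <= #|` p|) old &
      perm_eq (profiles s) (old ++ map (rename f) (recent j))].

Lemma renewed0 s : renewed 0 s.
Proof.
exists (profiles s), id; split; first by exists id.
  by apply/allP.
by rewrite cats0.
Qed.

Lemma renewed_same j s s' : same_collection s s' -> renewed j s -> renewed j s'.
Proof.
move=> /asboolP[h bh ss'] [old [f [bf oldj sE]]].
exists (map (rename h) old), (h \o f); split; first exact: bij_comp.
  rewrite all_map; apply/allP => p /(allP oldj) /=.
  by rewrite card_rename//; exact: bij_inj.
rewrite perm_sym in ss'; apply: perm_trans ss' _.
by rewrite (eq_map (rename_comp f h)) map_comp -map_cat perm_map.
Qed.

Lemma mem_newcomer m i c : i < n0 -> c \in newcomer m i -> m <= c < m + n0.
Proof.
move=> i0; rewrite !inE => /orP[/eqP ->|/eqP ->]; last by rewrite leq_addr ltn_add2l.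
case: ifP => _; first by rewrite leqnSn -addn1 ltn_add2l.
by rewrite leqnn -[X in X < _]addn0 ltn_add2l ltnW.
Qed.

(** Hence the names from [j * n0] on are free for the next newcomers. *)
Lemma recent_lt j p c : p \in recent j -> c \in p -> c < j * n0.
Proof.
elim: j p => //= j IH p; rewrite mem_filter mem_cat => /andP[_ /orP[]].
  move=> /mapP[q qj ->]; rewrite in_fset1U => /predU1P[->|/(IH _ qj)].
    by rewrite mulSn -[X in X < _]add0n ltn_add2r ltnW.
  by rewrite mulSn => h; apply: leq_trans h (leq_addl _ _).
move=> /mapP[i + ->]; rewrite mem_iota => i0 /(mem_newcomer i0).
by rewrite mulSn addnC => /andP[].
Qed.

Lemma rename_newcomer f c m i : i < n0 ->
  (forall l, l < n0 -> f (c + l) = m + l) -> rename f (newcomer c i) = newcomer m i.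
Proof.
move=> i0 fm; rewrite renameU1 rename1 fm// /newcomer.
case: ifP => _; first by rewrite -addn1 fm// addn1.
by rewrite -[X in f X]addn0 fm ?addn0// ltnW.
Qed.

Lemma kept_cat t t' : kept k (t ++ t') = kept k t ++ kept k t'.
Proof. exact: filter_cat. Qed.

(** The old peers gain the fresh chunk [m]. Away from the names in use, [f] is modified into a
    bijection that sends [j * n0 + l] to [m + l]. *)
Lemma renewed_step j s : renewed j s ->
  renewed j.+1 (pmap insub (renewal (next_chunk (profiles s)) (profiles s)) : config k).
Proof.
move=> [old [f [bf oldj sE]]]; set m := next_chunk _.
pose c0 := j * n0.
(* Names below [c0] that do not occur are left out: [f] may send them to names from [m] on, where
   [g] would not be injective. *)
pose X := [seq c <- iota 0 c0 | has (fun p => c \in p) (recent j)] ++ iota c0 n0.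
pose g c := if c < c0 then f c else m + (c - c0).
have gm c : c \in X -> c < c0 -> g c < m.
  move=> cX cc0; move: cX; rewrite mem_cat => /orP[]; last first.
    by rewrite mem_iota; move: cc0; case: leqP.
  rewrite mem_filter => /andP[/hasP[p pj cp] _]; rewrite /g cc0.
  apply: (@next_chunk_gt _ (rename f p)); last by rewrite mem_rename//; exact: bij_inj.
  by rewrite (perm_mem sE) mem_cat map_f ?orbT.
have gi : {in X &, injective g}.
  move=> i l iX lX; have := gm i iX; have := gm l lX; rewrite /g.
  case: (ltnP i c0) => ic; case: (ltnP l c0) => lc //.
  - by move=> _ _; exact: (bij_inj bf).
  - by move=> _ /(_ isT) + E; rewrite E; lia.
  - by move=> /(_ isT) + _ E; rewrite -E; lia.
  - by move=> _ _; lia.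
have [f' bf' f'g] := extend_injective gi.
have f'old p : p \in recent j -> rename f' p = rename f p.
  move=> pj; apply: eq_in_rename => c cp; have cc0 := recent_lt pj cp.
  rewrite f'g /g ?cc0// mem_cat mem_filter mem_iota cc0 /= andbT.
  by apply/orP; left; apply/hasP; exists p.
have f'new l : l < n0 -> f' (c0 + l) = m + l.
  move=> l0; rewrite f'g; last by rewrite mem_cat mem_iota leq_addr ltn_add2l l0 orbT.
  by rewrite /g ltnNge leq_addr addKn.
exists (kept k [seq m |` p | p <- old]), f'; split=> //.
  apply/allP => p; rewrite mem_filter => /andP[_ /mapP[q qold ->]].
  rewrite cardfsU1 (_ : m \notin q) ?add1n ?ltnS; first exact: (allP oldj).
  rewrite -[m]addn0; apply: fresh_notin.
  by rewrite (perm_mem sE) mem_cat qold.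
rewrite profiles_pmap_insub /= -kept_rename; last exact: bij_inj.
rewrite -kept_cat; apply: perm_filter.
rewrite /renewal map_cat -!map_comp catA; apply: perm_cat; last first.
  have -> : map (rename f' \o newcomer c0) (iota 0 n0) = map (newcomer m) (iota 0 n0).
    by apply/eq_in_map => i; rewrite mem_iota => i0 /=; exact: rename_newcomer.
  exact: perm_refl.
have -> : map (rename f' \o fsetU [fset c0]) (recent j) =
    [seq m |` p | p <- map (rename f) (recent j)].
  rewrite -map_comp; apply/eq_in_map => p pj /=.
  by rewrite renameU1 f'old// -[c0]addn0 f'new ?addn0// ltnW.
by rewrite -map_cat map_comp perm_map.
Qed.

Lemma kept_recent j : kept k (recent j) = recent j.
Proof. by case: j => //= j; rewrite {1}/kept filter_id. Qed.

(** In a state every profile has fewer than [k] chunks, so [old] is empty. *)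
Lemma renewed_full s : renewed k s ->
  same_collection (pmap insub (recent k) : config k) s.
Proof.
move=> [old [f [bf oldk sE]]]; apply/asboolP; exists f => //.
have old0 : old = [::].
  case: old oldk sE => //= p old /andP[kp _] sE.
  have : p \in profiles s by rewrite (perm_mem sE) mem_head.
  by move=> /card_profiles; rewrite ltnNge kp.
rewrite perm_sym profiles_pmap_insub; move: sE; rewrite old0 /=.
by rewrite kept_recent.
Qed.

End Renewal.

(** * Probability of the chosen outcome *)

Section RenewalProbability.
Local Open Scope fset_scope.
Local Open Scope ring_scope.
Context {R : realType}.
Variables (k A : nat) (a : nat -> R) (lambda : R) (n0 : nat).
Hypothesis n0_gt1 : (1 < n0 < A)%N.

Lemma mem_exchange1 (p : {fset nat}) c : c \notin p ->
  ((1 : R), c |` p) \in exchange p [fset c].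
Proof.
move=> cp; rewrite /exchange; have -> : [fset c] `\` p = [fset c].
  by apply/fsetP => i; rewrite !inE; case: eqP => [->|]; rewrite ?cp ?andbF.
rewrite -fsubset0 fsub1set inE -[X in (X, _)]mulr1.
apply: mem_bind; last exact: mem_head.
have := @mem_uniform R _ (enum_fset [fset c]) c; rewrite cardfs1 invr1; apply.
by rewrite fset11.
Qed.

(** The factors are those of [n0] arrivals, of [n0] selections and of [size s + n0] prescribed
    contacts; each contacted newcomer holds a single chunk, which settles the download. *)
Lemma mem_renewal (s : config k) (d : R) : d = (size s + n0).-1%:R^-1 ->
  (a n0 * lambda^-1 ^+ n0 * d ^+ (size s + n0),
    pmap insub (renewal n0 (next_chunk (profiles s)) (profiles s)) : config k)
  \in @slot R k A a lambda s.
Proof.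
move=> dE; set m := next_chunk _; case/andP: n0_gt1 => n01 n0A.
have n00 := ltnW n01.
pose t := after_arrivals s (nseq n0 true).
have tE : (size t = size s + n0)%N by rewrite size_after_arrivals size_nseq.
have arrE : arrivals m (nseq n0 true) = [seq [fset (m + i)%N] | i <- iota 0 n0].
  rewrite /arrivals size_nseq; apply/eq_in_map => i; rewrite mem_iota /= add0n => i0.
  by rewrite nth_nseq i0.
have tnew i : (i < n0)%N -> nth fset0 t (size s + i) = [fset (m + i)%N].
  move=> i0; rewrite /t /after_arrivals -/m arrE nth_cat size_map ltnNge leq_addr /=.
  by rewrite addKn (nth_map 0%N) ?size_iota// nth_iota.
have told i : (i < size s)%N -> nth fset0 t i = nth fset0 (profiles s) i.
  by move=> is_; rewrite nth_cat size_map is_.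
(* Position [size s] is that of the first newcomer, the only peer that contacts the second one. *)
pose c i := if i == size s then m.+1 else m.
have hc : {in iota 0 (size t), forall i,
    (d, (c i) |` nth fset0 t i) \in contact (R := R) t i}.
  move=> i; rewrite mem_iota tE /= add0n => it.
  rewrite contactE -[X in (X, _)]mulr1 dE.
  pose j := if i == size s then (size s).+1 else size s.
  apply: (@mem_bind _ _ _ _ _ _ j).
    have := @mem_uniform R _ [seq l <- iota 0 (size t) | l != i] j.
    rewrite size_others ?tE//; apply; rewrite mem_filter mem_iota /j.
    case: (eqVneq i (size s)) => [->|ine] /=; last by rewrite eq_sym ine/= ; lia.
    by rewrite -addn1 -[X in _ != X]addn0 eqn_add2l /=; lia.
  have -> : nth fset0 t j = [fset c i].
    rewrite /j /c; case: ifP => _; last by rewrite -[X in nth _ _ X]addn0 tnew ?addn0.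
    by rewrite -addn1 tnew// addn1.
  apply: mem_exchange1; rewrite /c.
  case: (ltngtP i (size s)) => ins.
  - rewrite told// -[m]addn0; apply: fresh_notin; apply: mem_nth.
    by rewrite size_map.
  - rewrite -(subnKC (ltnW ins)) tnew; last by rewrite ltn_subLR // ltnW.
    by rewrite inE -[X in X == _]addn0 eqn_add2l eq_sym subn_eq0 -ltnNge.
  - by rewrite ins -[size s]addn0 tnew// inE addn0 -addn1 -[X in _ == X]addn0 eqn_add2l.
have hx := mem_indep hc; rewrite size_iota tE in hx.
have xE : map (fun i => c i |` nth fset0 t i) (iota 0 (size s + n0)) =
    renewal n0 m (profiles s).
  rewrite iotaD map_cat; congr (_ ++ _).
    apply: (@eq_from_nth _ fset0); rewrite !size_map size_iota// => i is_.
    rewrite (nth_map 0%N) ?size_iota// nth_iota// add0n told//.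
    rewrite (nth_map fset0) ?size_map// /c ifF//.
    by apply/negP => /eqP ie; rewrite ie ltnn in is_.
  rewrite -[X in iota X _](addn0 (0 + size s)%N) iotaDl -map_comp; apply/eq_in_map => i.
  rewrite mem_iota => i0 /=; rewrite tnew// /newcomer /c add0n.
  by rewrite -[X in _ == X]addn0 eqn_add2l.
rewrite {}xE in hx.
have -> : a n0 * lambda^-1 ^+ n0 * d ^+ (size s + n0) =
    a n0 * (lambda^-1 ^+ n0 * 1) * (d ^+ (size s + n0) * 1) by rewrite !mulr1.
apply: (@mem_bind _ _ _ _ _ _ t).
  apply: (@mem_bind _ _ _ _ _ _ n0).
    by apply/mapP; exists n0 => //; rewrite mem_iota.
  apply: (@mem_bind _ _ _ _ _ _ (nseq n0 true)); last exact: mem_head.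
  have := @mem_indep R _ _ (fun=> coin lambda) (nseq n0 tt) lambda^-1 (fun=> true).
  rewrite size_nseq !map_nseq; apply=> _ _.
  by rewrite /coin div1r mem_head.
apply: (@mem_bind _ _ _ _ _ _ (renewal n0 m (profiles s))); first by rewrite -tE in hx *.
exact: mem_head.
Qed.
End RenewalProbability.

Local Open Scope quotient_scope.
Local Open Scope ring_scope.

(** * The chain on the quotient and its base state *)

Section Quotient.
Context {R : realType}.
Variables (k A : nat) (a : nat -> R) (lambda : R).
Hypothesis a_ge0 : forall n, 0 <= a n.
Hypothesis a_supp : forall n, a n != 0 -> (1 < n < A)%N.
Hypothesis a_sum : \sum_(n < A) a n = 1.
Hypothesis lambda_gt1 : 1 < lambda.
Implicit Types (s : config k) (x y : state k).

Local Notation slot := (@slot R k A a lambda).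

Definition law x : dist R (state k) := [seq (w.1, \pi_(state k) w.2) | w <- slot (repr x)].

Lemma expect_law x f : expect (law x) f = expect (slot (repr x)) (fun s => f (\pi_(state k) s)).
Proof. by rewrite /expect big_map. Qed.

Lemma proba_law x : proba (law x).
Proof.
have [s0 s1] := proba_slot a_ge0 a_supp a_sum lambda_gt1 (repr x); split.
  by move=> w /mapP[v vs ->]; exact: s0.
by rewrite big_map.
Qed.

Lemma transition_law x y : transition A a lambda x y = dprob (law x) (pred1 y).
Proof. by rewrite /transition /dprob big_map. Qed.

Lemma repr_pi_same s : same_collection (repr (\pi_(state k) s)) s.
Proof. by have /eqmodP := reprK (\pi_(state k) s). Qed.

Variable n0 : nat.
Hypothesis an0 : 0 < a n0.
Hypothesis k_gt0 : (0 < k)%N.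

Let n0A : (1 < n0 < A)%N. Proof. by apply: a_supp; rewrite gt_eqF. Qed.

Definition base_state : state k := \pi_(state k) (pmap insub (recent k n0 k)).


(** A lower bound on the weight in [mem_renewal], uniform over the states of at most [N] peers. *)
Definition step_weight N : R := a n0 * lambda^-1 ^+ n0 * (N + n0)%:R^-1 ^+ (N + n0).

Lemma step_weight_gt0 N : 0 < step_weight N.
Proof.
case/andP: n0A => n01 _.
rewrite !mulr_gt0// exprn_gt0// invr_gt0 ?(lt_trans _ lambda_gt1)// ltr0n.
by rewrite addn_gt0 (ltnW n01) orbT.
Qed.

Local Notation ret := (avoid law [set base_state]%classic).

(** [N] bounds the population throughout the [i] remaining slots. The case [i = 0] is stated apart
    because [avoid] ignores the starting state. *)
Lemma reach_base N i j x : (i + j = k)%N -> renewed n0 j (repr x) ->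
  (size (repr x) + i * n0 <= N)%N ->
  (i = 0 -> x = base_state)%N /\ ((0 < i)%N -> step_weight N ^+ i <= 1 - ret i x).
Proof.
elim: i j x => [|i IH] j x ijk xj xN.
  split=> // _; rewrite -[x]reprK; apply/eqmodP.
  rewrite /= same_collection_sym; apply: renewed_full => //.
  by move: ijk xj; rewrite add0n => ->.
split=> // _.
case/andP: n0A => n01 _.
set s' := (pmap insub (renewal n0 (next_chunk (profiles (repr x))) (profiles (repr x))) : config k).
pose y := \pi_(state k) s'.
have yj : renewed n0 j.+1 (repr y).
  apply: renewed_same (renewed_step n01 k_gt0 xj).
  by rewrite same_collection_sym; exact: repr_pi_same.
have yN : (size (repr y) + i * n0 <= N)%N.
  rewrite (size_same (repr_pi_same s')); apply: leq_trans xN.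
  rewrite mulSn addnA leq_add2r -(size_map val) -/(profiles s') profiles_pmap_insub.
  apply: leq_trans (size_kept _ _) _.
  by rewrite size_cat !size_map size_iota.
have ijk' : (i + j.+1 = k)%N by rewrite addnS -addSn.
have [y0 yi] := IH j.+1 y ijk' yj yN.
set d : R := (size (repr x) + n0).-1%:R^-1.
set r := a n0 * lambda^-1 ^+ n0 * d ^+ (size (repr x) + n0).
have xy : (r, y) \in law x.
  by apply/mapP; exists (r, s') => //; exact: mem_renewal.
have wr : step_weight N <= r.
  have c0 : 0 <= a n0 * lambda^-1 ^+ n0.
    apply: mulr_ge0; first exact: a_ge0.
    by rewrite exprn_ge0// invr_ge0 ltW// (lt_trans _ lambda_gt1).
  rewrite ler_wpM2l//.
  have le1 : (size (repr x) + n0 <= N + n0)%N.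
    by rewrite leq_add2r; apply: leq_trans xN; rewrite leq_addr.
  have d0 : (0 < (size (repr x) + n0).-1)%N.
    by rewrite -subn1 subn_gt0 (leq_trans n01)// leq_addl.
  have N1 : (0 < N + n0)%N by rewrite addn_gt0 (ltnW n01) orbT.
  apply: (@le_trans _ _ ((N + n0)%:R^-1 ^+ (size (repr x) + n0))).
    by apply: ler_wiXn2l => //; rewrite invf_le1 ?ler1n ?ltr0n.
  apply: lerXn2r; rewrite ?nnegrE ?invr_ge0// /d lef_pV2 ?posrE ?ltr0n//.
  by rewrite ler_nat (leq_trans _ le1)// leq_pred.
have w0 := step_weight_gt0 N.
apply: le_trans (avoid_step proba_law _ i xy).
(* If the base state is met early, a single factor suffices, since the weights are at most [1]. *)
have [|yNb] := boolP (y \in [set base_state]%classic).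
  rewrite mulr1 => _; apply: le_trans (wr); rewrite exprS ger_pMr//.
  apply: exprn_ile1; first exact: ltW.
  apply: le_trans wr _; have [nn _] := proba_law x.
  have := expect_le_support (f := fun=> 1) nn (fun _ _ => ler01) xy.
  by rewrite mulr1 expect_cst//; exact: proba_law.
case: i IH ijk xN yN y0 yi ijk' => [|i] IH ijk xN yN y0 yi _.
  by case/negP: yNb; rewrite y0// mem_set.
rewrite exprS; apply: ler_pM => //; first exact: ltW.
  by rewrite exprn_ge0// ltW.
exact: yi.
Qed.

End Quotient.

(* [a n] is the probability that [n] peers arrive in a slot. *)
Theorem mainTheorem1 (R : realType) (k A : nat) (a : nat -> R) (lambda : R)
  (a_ge0 : forall n, 0 <= a n)
  (a_supp : forall n, a n != 0 -> (1 < n < A)%N)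
  (a_sum : \sum_(n < A) a n = 1)
  (a_mean : \sum_(n < A) n%:R * a n = lambda)
  (lambda_gt1 : 1 < lambda)
  (lambda_ltk : lambda < k%:R) :
  positive_recurrent (@transition R k A a lambda).
Proof.
have [n0 an0] : exists n0, 0 < a n0.
  apply: contrapT => /forallNP a0.
  have : \sum_(n < A) a n = 0.
    apply: big1 => n _; apply/eqP; rewrite eq_le a_ge0 andbT leNgt.
    by apply/negP; exact: a0.
  by rewrite a_sum => /eqP; rewrite oner_eq0.
have k_gt0 : (0 < k)%N.
  by have := lt_trans lambda_gt1 lambda_ltk; rewrite ltr1n => /ltnW.
have [N0 [eps [eps0 drf]]] := drift a_ge0 a_supp a_sum a_mean lambda_gt1 lambda_ltk.
pose V (x : state k) := @potential R k A (repr x).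
have Vpi (s : config k) : V (\pi_(state k) s) = potential A s.
  by rewrite /V /potential (lyap_same _ _ (repr_pi_same s)).
have EV x : expect (law A a lambda x) V =
    expect (slot A a lambda (repr x)) (@potential R k A).
  by rewrite expect_law; apply: eq_expect_fun => s; rewrite Vpi.
have reach x N : (size (repr x) + k * n0 <= N)%N ->
    step_weight a lambda n0 N ^+ k <=
    1 - avoid (law A a lambda) [set base_state k n0]%classic k x.
  move=> xN; have [_] := reach_base a_ge0 a_supp a_sum lambda_gt1 an0 k_gt0
    (addn0 k) (renewed0 n0 (repr x)) xN.
  exact.
(* [F] gathers the states of fewer than [N0] peers; over [k] slots with [n0] arrivals each, their
   population stays below [N0 + k * n0], hence a uniform [delta]. *)
apply: (@foster_positive_recurrent R _ _ (law A a lambda) _ _ V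
    [set x | (size (repr x) < N0)%N]%classic eps
    (k * A + 2 * (k * A).+1 * (k * A).+2)%:R
    (step_weight a lambda n0 (N0 + k * n0) ^+ k) k (base_state k n0)) => //.
- exact: proba_law.
- exact: transition_law.
- by rewrite exprn_gt0// (step_weight_gt0 a_supp).
- by move=> x /negP; rewrite -leqNgt EV => /drf.
- move=> x _; rewrite EV.
  exact: (slot_bounded a_ge0 a_supp a_sum a_mean lambda_gt1 lambda_ltk).
- by move=> x /= xN; apply: reach; rewrite leq_add2r ltnW.
- move=> x; exists k; rewrite -subr_gt0; apply: lt_le_trans (reach _ _ (leqnn _)).
  by rewrite exprn_gt0// (step_weight_gt0 a_supp).
Qed.
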